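(* The twisted rational zeros of the Tribonacci sequence $T$ are exactly $0,-1,-4,-17,\frac13,-\frac53$.
   Context: The Tribonacci sequence is the map $T:\mathbb{Z}\to\mathbb{Q}$ with $T(0)=0$, $T(1)=T(2)=1$ and $T(n+3)=T(n+2)+T(n+1)+T(n)$ for all $n\in\mathbb{Z}$. With $\lambda_1,\lambda_2,\lambda_3$ the roots of $P(X)=X^3-X^2-X-1$ one has $T(n)=\alpha_1\lambda_1^n+\alpha_2\lambda_2^n+\alpha_3\lambda_3^n$ with $\alpha_i=\lambda_i/P'(\lambda_i)$. For $a=k/\ell\in\mathbb{Q}$ in lowest terms with $\ell>0$, a determination of $\lambda_i^a$ is $\mu^k$ with $\mu\in\overline{\mathbb{Q}}$, $\mu^\ell=\lambda_i$. A rational number $a$ is a twisted rational zero of $T$ if for some determinations of $\lambda_1^a,\lambda_2^a,\lambda_3^a$ and some roots of unity $\xi_1,\xi_2,\xi_3$ we have $\xi_1\alpha_1\lambda_1^a+\xi_2\alpha_2\lambda_2^a+\xi_3\alpha_3\lambda_3^a=0$. *)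

(* Defs.v *)
From HB Require Import structures.
From mathcomp Require Import all_boot all_order all_algebra all_field.
From mathcomp Require Import ring.

Set Implicit Arguments.
Unset Strict Implicit.
Unset Printing Implicit Defensive.

Import Order.TTheory GRing.Theory Num.Theory.
Local Open Scope ring_scope.

(* The two-sided sequence is computed on windows (T n, T (n + 1), T (n + 2)),
   shifted forwards or backwards by the recurrence.                           *)
Definition trib_fwd (s : rat * rat * rat) : rat * rat * rat :=
  let: (x, y, z) := s in (y, z, z + y + x).

Definition trib_bwd (s : rat * rat * rat) : rat * rat * rat :=
  let: (x, y, z) := s in (z - y - x, x, y).

Definition trib_window (n : int) : rat * rat * rat :=
  match n with
  | Posz m => iter m trib_fwd (0, 1, 1)
  | Negz m => iter m.+1 trib_bwd (0, 1, 1)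
  end.

Definition trib (n : int) : rat := (trib_window n).1.1.

Definition trib_poly : {poly algC} := 'X^3 - 'X^2 - 'X - 1.

Definition trib_roots (lambda : 'I_3 -> algC) : Prop :=
  trib_poly = \prod_i ('X - (lambda i)%:P).

Definition trib_coef (lambda : 'I_3 -> algC) (i : 'I_3) : algC :=
  lambda i / trib_poly^`().[lambda i].

(* [denq a] is positive and coprime to [numq a]; both exponents are integers,
   so [^] is the integer power of ssrint.                                     *)
Definition determination (x : algC) (a : rat) (y : algC) : Prop :=
  exists mu : algC, mu ^ denq a = x /\ y = mu ^ numq a.

(* The order must be required positive: every element is a 0.-unity_root.     *)
Definition root_of_unity (xi : algC) : Prop :=
  exists n : nat, (0 < n)%N /\ n.-unity_root xi.

(* Depends on [trib] through its closed form, lemma [trib_binet] below.       *)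
Definition twisted_rational_zero (lambda : 'I_3 -> algC) (a : rat) : Prop :=
  exists xi y : 'I_3 -> algC,
    [/\ forall i, root_of_unity (xi i),
        forall i, determination (lambda i) a (y i)
      & \sum_i xi i * trib_coef lambda i * y i = 0].

Lemma NegzS1 (m : nat) : Negz m.+1 + 1 = Negz m.
Proof. by rewrite !NegzE -[m.+2]addn1 PoszD opprD addrNK. Qed.

Lemma trib_windowS (n : int) : trib_window (n + 1) = trib_fwd (trib_window n).
Proof.
have fK s : trib_fwd (trib_bwd s) = s.
  by case: s => [[x y] z] /=; congr (_, _, _); ring.
case: n => [m|[|m]]; first by rewrite -PoszD addn1.
- by rewrite (_ : Negz 0 + 1 = 0) //= /trib_window /= fK.
rewrite NegzS1.
by rewrite [in RHS]/trib_window iterS fK.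
Qed.

Lemma trib0 : trib 0 = 0. Proof. by []. Qed.
Lemma trib1 : trib 1 = 1. Proof. by []. Qed.
Lemma trib2 : trib 2 = 1. Proof. by []. Qed.

Lemma trib_rec (n : int) :
  trib (n + 3) = trib (n + 2) + trib (n + 1) + trib n.
Proof.
have -> : n + 3 = n + 1 + 1 + 1 by ring.
have -> : n + 2 = n + 1 + 1 by ring.
by rewrite /trib !trib_windowS; case: (trib_window n) => [[x y] z].
Qed.

Lemma trib_root (lambda : 'I_3 -> algC) (i : 'I_3) :
  trib_roots lambda -> lambda i ^+ 3 = lambda i ^+ 2 + lambda i + 1.
Proof.
move=> H; have : trib_poly.[lambda i] = 0.
  by rewrite H horner_prod (bigD1 i) //= !hornerE subrr mul0r.
rewrite /trib_poly !hornerE => E.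
by apply/eqP; rewrite -subr_eq0 -E; apply/eqP; ring.
Qed.

Lemma trib_deriv_neq0 (lambda : 'I_3 -> algC) (i : 'I_3) :
  trib_roots lambda -> trib_poly^`().[lambda i] != 0.
Proof.
move=> /(trib_root i) H; apply/eqP.
rewrite /trib_poly !derivE !hornerE /= => E.
set x := lambda i in H E.
have E' : 3 * x ^+ 2 - 2 * x - 1 = 0 by rewrite -E; ring.
have : (22 : algC) = 0.
  have -> : (22 : algC) = (1 + 9 * x - 4 * x ^+ 2) * (3 * x ^+ 2 - 2 * x - 1)
     + (12 * x - 23) * (x ^+ 3 - (x ^+ 2 + x + 1)) by ring.
  by rewrite E' H subrr !mulr0 addr0.
by move/eqP; rewrite pnatr_eq0.
Qed.

Lemma trib_roots_ex : exists lambda, trib_roots lambda.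
Proof.
have sP : size trib_poly = 4.
  rewrite /trib_poly -!addrA size_polyDl size_polyXn //.
  apply: (@leq_ltn_trans 3) => //.
  apply: (leq_trans (size_polyD _ _)); rewrite size_polyN size_polyXn geq_max /=.
  apply: (leq_trans (size_polyD _ _)).
  by rewrite !size_polyN size_polyX size_poly1.
have [r rE] := closed_field_poly_normal trib_poly.
have lP : lead_coef trib_poly = 1.
  by rewrite lead_coefE sP /trib_poly !coefE /= !subr0.
rewrite lP scale1r in rE.
have sr : size r = 3%N by apply/eqP; rewrite -eqSS -(size_prod_XsubC r id) -rE sP.
by exists (fun i => r`_i); rewrite /trib_roots rE (big_nth 0) big_mkord sr.
Qed.

Lemma trib_binet (lambda : 'I_3 -> algC) (n : int) : trib_roots lambda ->
  ratr (trib n) = \sum_i trib_coef lambda i * lambda i ^ n.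
Proof.
move=> H.
pose f (k : int) : algC := \sum_i trib_coef lambda i * lambda i ^ k.
pose F (s : rat * rat * rat) (k : int) : Prop :=
  [/\ ratr s.1.1 = f k, ratr s.1.2 = f (k + 1) & ratr s.2 = f (k + 2)].
have l0 i : lambda i != 0.
  apply/eqP => E; have /eqP := trib_root i H.
  by rewrite E !expr0n /= !add0r eq_sym oner_eq0.
have frec k : f (k + 3) = f (k + 2) + f (k + 1) + f k.
  rewrite /f -!big_split /=; apply: eq_bigr => i _.
  rewrite !expfzDr // !expr1z.
  rewrite (_ : lambda i * (lambda i * lambda i) = lambda i ^+ 3); last by ring.
  by rewrite trib_root //; ring.
suff : F (trib_window n) n by case.
have base : F (0, 1, 1) 0.
  pose x := lambda ord0; pose y := lambda (lift ord0 ord0).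
  pose z := lambda (lift ord0 (lift ord0 ord0)).
  have PE : trib_poly = ('X - x%:P) * (('X - y%:P) * ('X - z%:P)).
    by rewrite H !big_ord_recl big_ord0 mulr1.
  have S1 : x + y + z = 1.
    have E t : trib_poly.[t] = (t - x) * ((t - y) * (t - z)).
      by rewrite PE !hornerE.
    have {E} : trib_poly.[2] - 2 * trib_poly.[1] + trib_poly.[0]
               = 6 - 2 * (x + y + z) by rewrite !E; ring.
    rewrite /trib_poly !hornerE /= => E.
    have n2 : (2 : algC) != 0 by rewrite pnatr_eq0.
    apply: (mulfI n2).
    have -> : 2 * (x + y + z) = 6 - (6 - 2 * (x + y + z)) by ring.
    by rewrite -E !expr1n !expr0n /=; ring.
  have dx : trib_poly^`().[x] = (x - y) * (x - z).
    by rewrite PE !derivE !hornerE /=; ring.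
  have dy : trib_poly^`().[y] = (y - x) * (y - z).
    by rewrite PE !derivE !hornerE /=; ring.
  have dz : trib_poly^`().[z] = (z - x) * (z - y).
    by rewrite PE !derivE !hornerE /=; ring.
  have := trib_deriv_neq0 ord0 H.
  have := trib_deriv_neq0 (lift ord0 ord0) H.
  rewrite -/x -/y dx dy !mulf_eq0 !negb_or => /andP[_ nyz] /andP[nxy nxz].
  have nyx : y - x != 0 by rewrite -opprB oppr_eq0.
  have nzx : z - x != 0 by rewrite -opprB oppr_eq0.
  have nzy : z - y != 0 by rewrite -opprB oppr_eq0.
  have fE k : f k = x / ((x - y) * (x - z)) * x ^ k
      + (y / ((y - x) * (y - z)) * y ^ k + z / ((z - x) * (z - y)) * z ^ k).
    by rewrite /f !big_ord_recl big_ord0 addr0 /trib_coef -/x -/y -/z dx dy dz.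
  have R0 : ratr 0 = 0 :> algC by exact: rmorph0.
  have R1 : ratr 1 = 1 :> algC by exact: rmorph1.
  split=> /=; rewrite fE ?add0r.
  - by rewrite [ratr _]R0 !expr0z; field; rewrite ?nxy ?nxz ?nyz ?nyx ?nzx ?nzy.
  - by rewrite [ratr _]R1 !expr1z; field; rewrite ?nxy ?nxz ?nyz ?nyx ?nzx ?nzy.
  rewrite [ratr _]R1 -!exprnP -[LHS]S1; field.
  by rewrite ?nxy ?nxz ?nyz ?nyx ?nzx ?nzy.
have fwd s k : F s k -> F (trib_fwd s) (k + 1).
  case: s => [[a b] c] [/= E0 E1 E2]; split => //=.
    by rewrite E2; congr f; ring.
  have -> : k + 1 + 2 = k + 3 by ring.
  by rewrite frec !rmorphD /= E0 E1 E2.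
have bwd s k : F s (k + 1) -> F (trib_bwd s) k.
  case: s => [[a b] c] [/= E0 E1 E2]; split => //=.
    have {}E2 : ratr c = f (k + 3) by rewrite E2; congr f; ring.
    have {}E1 : ratr b = f (k + 2) by rewrite E1; congr f; ring.
    by rewrite !rmorphB /= E0 E1 E2 frec; ring.
  by rewrite E1; congr f; ring.
case: n => m.
  elim: m => [//|m IHm].
  by rewrite -addn1 PoszD trib_windowS; apply: fwd.
elim: m => [|m IHm]; first exact: bwd.
by apply: bwd; rewrite NegzS1.
Qed.

(* Main.v *)
(** Let lambda_1 = t be the real root and x_1 + x_2 + x_3 = 0 a twisted relation.
    Since lambda_2 and lambda_3 are conjugate, |x_2| = |x_3|, so the three terms
    form an isosceles triangle and x_1^2 / (x_2 x_3) = |x_1|^2 / |x_2|^2 is a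
    positive number depending only on the absolute values of the terms; hence
    it is fixed by every automorphism fixing t.  It equals 44 alpha_1^3 t^(3a)
    with t^(3a) > 0, and t is not a proper power of a positive element of Q(t)
    (comparing traces, such a root of t would be the real root of X^3 - X - 1),
    so b = 3a is an integer.  Applying an automorphism that moves t to lambda_2,
    the three ratios x_i^3 / (x_1 x_2 x_3) are the 44 alpha_i^3 lambda_i^b up to
    order, and their sum is 3.  Thus W(b) = 3, where
    W(b) = 44 sum_i alpha_i^3 lambda_i^b is an integral Tribonacci-like sequence.

    Skolem's method modulo 397 solves W(b) = 3: the roots satisfy
    lambda^132 = 1 (mod 397), exactly six residues of b modulo 132 survive modulo
    397, and in each of them lambda^(132 m) = 1 + 397 m beta (mod 397^(v(m)+2)),
    v being the 397-adic valuation, makes the solution unique.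

    Conversely x^3 + y^3 + z^3 - 3 x y z splits into linear forms over the cube
    roots of unity, so W(b) = 3 produces a twisted relation with a = b/3. *)

Require Import Defs.
From HB Require Import structures.
From Stdlib Require Import ZArith.
From mathcomp Require Import all_boot all_order all_algebra all_field.
From mathcomp Require Import ring lra zify ssrZ.

Set Implicit Arguments.
Unset Strict Implicit.
Unset Printing Implicit Defensive.

Import Order.TTheory GRing.Theory Num.Theory.
Local Open Scope ring_scope.

(* MathComp's [int_scope] has taken over the key [Z]. *)
Delimit Scope Z_scope with ZZ.
Local Arguments Z.add : simpl never.
Local Arguments Z.sub : simpl never.
Local Arguments Z.mul : simpl never.

(** * Automorphisms of the algebraic numbers *)

(** The splitting field of the minimal polynomial is normal over the rationals, so one of its
    automorphisms carries [x] to [y]; it then extends to all of [algC]. *)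
Lemma algC_conjugate_aut (x y : algC) :
  root (minCpoly x) y -> exists nu : {rmorphism algC -> algC}, nu x = y.
Proof.
move=> xy; have [r Dr] := closed_field_poly_normal (minCpoly x).
rewrite (monicP (minCpoly_monic x)) scale1r in Dr.
have [p [Dp _ dv_p]] := minCpolyP x.
have [Qn [QnC [rs Drs genQn]]] := num_field_exists r.
pose pn : {poly Qn} := map_poly (in_alg Qn) p.
have pnC : map_poly QnC pn = minCpoly x.
  by rewrite Dp -map_poly_comp; apply: eq_map_poly => a /=; rewrite alg_num_field fmorph_rat.
have pn_split : pn = \prod_(z <- rs) ('X - z%:P).
  apply: (map_poly_inj QnC); rewrite pnC Dr -Drs big_map rmorph_prod /=.
  by apply: eq_bigr => z _; rewrite map_polyXsubC.
have Qn_ax : FieldExt_isSplittingField _ Qn.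
  constructor; exists pn; last by exists rs; rewrite // -pn_split eqpxx.
  by apply/polyOverP=> i; rewrite coef_map /= memvZ ?mem1v.
pose Qs : splittingFieldType rat := HB.pack_for (splittingFieldType rat) Qn Qn_ax.
have in_rs z : root (minCpoly x) z -> exists u : Qn, QnC u = z.
  by rewrite Dr root_prod_XsubC -Drs => /mapP[u _ ->]; exists u.
have [u Du] := in_rs x (root_minCpoly x); have [v Dv] := in_rs y xy.
(* The minimal polynomial of [u] has rational coefficients and is therefore a multiple of that of
   [x], of which [y] is a root. *)
have uv : root (minPoly 1%VS (u : Qs)) (v : Qs).
  have [q Dq] : exists q : {poly rat}, minPoly 1%VS (u : Qs) = map_poly (in_alg Qs) q.
    have aP i : (minPoly 1 (u : Qs))`_i \in 1%VS.
      by apply/polyOverP; apply: minPolyOver.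
    have {aP} a_ i := sig_eqW (vlineP _ _ (aP i)).
    exists (\poly_(i < size (minPoly 1 (u : Qs))) sval (a_ i)).
    apply/polyP=> i; rewrite coef_map coef_poly.
    case: ifP => [_|/negbT]; last first.
      by rewrite -leqNgt => /(nth_default 0) ->; rewrite /= scale0r.
    by case: (a_ i).
  have qC z : root (map_poly ratr q : {poly algC}) (QnC z) =
              root (map_poly (in_alg Qs) q) z.
    rewrite -(fmorph_root QnC) -map_poly_comp.
    by congr (root _ _); apply: eq_map_poly => a /=; rewrite alg_num_field fmorph_rat.
  have := root_minPoly 1%AS (u : Qs).
  rewrite Dq -!qC Du Dv dv_p => /dvdpP[q1 ->].
  by rewrite rmorphM rootM /= -Dp xy orbT.
have [tau _ Dtau] :=
  normalField_root_minPoly (subvf 1) (normalFieldf 1) (memvf (u : Qs)) uv.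
have [nu Dnu] := extend_algC_subfield_aut QnC (gal_repr tau : {rmorphism Qs -> Qs}).
by exists nu; rewrite -Du -Dnu /= -[gal_repr tau u]/(tau u) Dtau.
Qed.

(** Every root of the minimal polynomial is a conjugate of [x], hence equal to [x]. Irreducibility
    in characteristic 0 makes the roots simple, so the polynomial is X - x, with rational constant
    term. *)
Lemma Crat_aut_fixed (x : algC) :
  (forall nu : {rmorphism algC -> algC}, nu x = x) -> x \in Crat.
Proof.
move=> fix_x; have [p [Dp mon_p dv_p]] := minCpolyP x.
have irr_p : irreducible_poly p.
  split=> [|q sq qp]; first by rewrite -(size_map_poly (ratr : rat -> algC)) -Dp size_minCpoly.
  have [r Dr] := dvdpP _ _ qp.
  have : root (map_poly ratr p) x by rewrite -Dp root_minCpoly.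
  rewrite Dr rmorphM rootM !dv_p => /orP[pr|pq]; last by rewrite /eqp -Dr qp pq.
  have p0 := monic_neq0 mon_p.
  have [r0 q0] : r != 0 /\ q != 0.
    by apply/andP; rewrite -negb_or -mulf_eq0 -Dr.
  have := dvdp_leq r0 pr; rewrite Dr size_mul //.
  have : (0 < size q)%N by rewrite lt0n size_poly_eq0.
  have : (0 < size r)%N by rewrite lt0n size_poly_eq0.
  have arith (a b : nat) : a != 1%N -> (0 < b)%N -> (0 < a)%N ->
    ((b + a).-1 <= b)%N -> False by lia.
  by move: sq => /arith/[apply]/[apply]/[apply].
have [r Dr] := closed_field_poly_normal (minCpoly x).
rewrite (monicP (minCpoly_monic x)) scale1r in Dr.
have sep_r : uniq r.
  rewrite -separable_prod_XsubC -Dr Dp separable_map.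
  rewrite separable_poly.unlock irreducible_poly_coprime //.
  apply/negP => /dvdp_leq; have [sp _] := irr_p.
  have p0 := irredp_neq0 irr_p; have := lt_size_deriv p0.
  have : p^`() != 0.
    apply: contraTneq sp => p'0; rewrite -leqNgt; apply/leq_sizeP => -[|i] // _.
    have /eqP := congr1 (fun q : {poly rat} => q`_i) p'0.
    by rewrite coef_deriv coef0 mulrn_eq0 => /eqP.
  by move=> -> lt /(_ isT); rewrite leqNgt lt.
have rx z : z \in r -> z = x.
  rewrite -root_prod_XsubC -Dr => /algC_conjugate_aut[nu <-]; exact: fix_x.
have xr : x \in r by rewrite -root_prod_XsubC -Dr root_minCpoly.
have {sep_r rx xr} r1 : r = [:: x].
  case: r sep_r rx xr {Dr} => [|a [|b s]] //= => [_ /(_ a) -> //|].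
    by rewrite mem_head.
  move=> /andP[+ _] rx _; rewrite (rx a) ?mem_head // (rx b) ?mem_head //.
  by rewrite !inE eqxx orbT.
have : (minCpoly x)`_0 = - x.
  by rewrite Dr r1 big_seq1 coefB coefX coefC /= sub0r.
by rewrite Dp coef_map /= => /eqP; rewrite eq_sym eqr_oppLR => /eqP->; rewrite rpredN Crat_rat.
Qed.

(** * Skolem's method *)

Lemma expr1D_order2 (R : comNzRingType) (z : R) (n : nat) :
  exists w, (1 + z) ^+ n = 1 + n%:R * z + z ^+ 2 * w.
Proof.
elim: n => [|n [w IHn]]; first by exists 0; rewrite expr0; ring.
exists (n%:R + w + z * w); by rewrite exprS IHn -natr1; ring.
Qed.

Lemma expr1D_order3 (R : comNzRingType) (z : R) (n : nat) :
  exists w, (1 + z) ^+ n = 1 + n%:R * z + 'C(n, 2)%:R * z ^+ 2 + z ^+ 3 * w.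
Proof.
elim: n => [|n [w IHn]]; first by exists 0; rewrite expr0 bin_small //; ring.
exists ('C(n, 2)%:R + w + z * w).
by rewrite exprS IHn binS bin1 natrD -natr1; ring.
Qed.

(** In the p-th power of 1 + p^(j+1) u the linear term is p^(j+2) u. For odd p, p divides
    ['C(p, 2)], so all later terms are divisible by p^(j+3). *)
Lemma expr1D_prime_pow (R : comNzRingType) (p : nat) (x : R) (j : nat) :
  prime p -> (2 < p)%N ->
  exists y, (1 + p%:R * x) ^+ (p ^ j) = 1 + p%:R ^+ j.+1 * (x + p%:R * y).
Proof.
move=> p_pr p_gt2; elim: j => [|j [y IHj]].
  by exists 0; rewrite expn0 !expr1; ring.
rewrite expnSr exprM IHj; set u := x + _.
have [w ->] := expr1D_order3 (p%:R ^+ j.+1 * u) p.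
have /dvdnP[q ->] : (p %| 'C(p, 2))%N by rewrite prime_dvd_bin.
exists (y + q%:R * p%:R ^+ j * u ^+ 2 + p%:R ^+ j.*2 * u ^+ 3 * w).
rewrite natrM /u -addnn exprD !exprS; ring.
Qed.

(** Split m as p^j r with j its valuation. The remainder has one factor p more than [p * m], which
    makes the linear term decisive. *)
Lemma expr1D_logn (R : comNzRingType) (p : nat) (x : R) (m : nat) :
  prime p -> (2 < p)%N -> (0 < m)%N ->
  exists y, (1 + p%:R * x) ^+ m =
    1 + (p * m)%:R * x + p%:R ^+ (logn p m).+2 * y.
Proof.
move=> p_pr p_gt2 m_gt0; set j := logn p m.
have [y yE] := expr1D_prime_pow x j p_pr p_gt2.
have /dvdnP[r mE] : (p ^ j %| m)%N by rewrite pfactor_dvdnn.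
rewrite mE mulnC exprM yE.
have [w ->] := expr1D_order2 (p%:R ^+ j.+1 * (x + p%:R * y)) r.
exists (r%:R * y + p%:R ^+ j * (x + p%:R * y) ^+ 2 * w).
rewrite !natrM natrX !exprS; ring.
Qed.

(** Binary integers make the powers and windows below computable. *)
Definition ZtoC : Z -> algC := intr \o int_of_Z.
HB.instance Definition _ := GRing.RMorphism.copy ZtoC (intr \o int_of_Z).

Lemma ZtoC_inj : injective ZtoC.
Proof. exact: inj_comp (@intr_inj _) (can_inj int_of_ZK). Qed.

Lemma ZtoCD (a b : Z) : ZtoC (a + b)%ZZ = ZtoC a + ZtoC b.
Proof. exact: rmorphD. Qed.

Lemma ZtoCB (a b : Z) : ZtoC (a - b)%ZZ = ZtoC a - ZtoC b.
Proof. exact: rmorphB. Qed.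

Lemma ZtoCM (a b : Z) : ZtoC (a * b)%ZZ = ZtoC a * ZtoC b.
Proof. exact: rmorphM. Qed.

Definition evalZ (x : algC) (q : {poly Z}) : algC := (map_poly ZtoC q).[x].

Lemma evalZD x : {morph evalZ x : q r / q + r}.
Proof. by move=> q r; rewrite /evalZ rmorphD hornerD. Qed.

Lemma evalZM x : {morph evalZ x : q r / q * r}.
Proof. by move=> q r; rewrite /evalZ rmorphM hornerM. Qed.

Lemma evalZX x (q : {poly Z}) n : evalZ x (q ^+ n) = evalZ x q ^+ n.
Proof. by rewrite /evalZ rmorphXn horner_exp. Qed.

Lemma evalZ_nat x n : evalZ x n%:R = n%:R.
Proof. by rewrite /evalZ rmorph_nat -polyC_natr hornerC. Qed.

(* A triple (a, b, c) stands for three consecutive terms in [trib_next] and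
   [trib_prev], and for a + b x + c x^2 in [pow_next] and [pow_prev]. *)
Definition trib_next (s : Z * Z * Z) := let: (a, b, c) := s in (b, c, a + b + c)%ZZ.
Definition trib_prev (s : Z * Z * Z) := let: (a, b, c) := s in (c - b - a, a, b)%ZZ.
Definition pow_next (s : Z * Z * Z) := let: (a, b, c) := s in (c, a + c, b + c)%ZZ.
Definition pow_prev (s : Z * Z * Z) := let: (a, b, c) := s in (b - a, c - a, a)%ZZ.

Definition quad_poly (s : Z * Z * Z) : {poly Z} :=
  let: (a, b, c) := s in a%:P + b%:P * 'X + c%:P * 'X^2.

Lemma eval_quad_poly x s :
  evalZ x (quad_poly s) = ZtoC s.1.1 + ZtoC s.1.2 * x + ZtoC s.2 * x ^+ 2.
Proof.
case: s => [[a b] c]; rewrite /evalZ /quad_poly.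
by rewrite !rmorphD !rmorphM /= map_polyX !map_polyC /= !hornerE.
Qed.

Lemma eval_pow_next (x : algC) (n : nat) : x ^+ 3 = x ^+ 2 + x + 1 ->
  evalZ x (quad_poly (iter n pow_next (1, 0, 0)%ZZ)) = x ^+ n.
Proof.
move=> x3; elim: n => [|n IHn].
  by rewrite eval_quad_poly /= [ZtoC 1]rmorph1 [ZtoC 0]rmorph0; ring.
rewrite iterS exprS -IHn !eval_quad_poly.
case: (iter _ _ _) => [[a b] c] /=; rewrite !ZtoCD.
have -> : x * (ZtoC a + ZtoC b * x + ZtoC c * x ^+ 2) =
  ZtoC a * x + ZtoC b * x ^+ 2 + ZtoC c * x ^+ 3 by ring.
by rewrite x3; ring.
Qed.

Lemma trib_root_neq0 (x : algC) : x ^+ 3 = x ^+ 2 + x + 1 -> x != 0.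
Proof.
by move=> x3; apply: contra_eqN x3 => /eqP->; rewrite !expr0n /= !add0r eq_sym oner_eq0.
Qed.

Lemma eval_pow_prev (x : algC) (n : nat) : x ^+ 3 = x ^+ 2 + x + 1 ->
  evalZ x (quad_poly (iter n pow_prev (1, 0, 0)%ZZ)) = x ^- n.
Proof.
move=> x3; have x0 := trib_root_neq0 x3; elim: n => [|n IHn].
  by rewrite eval_quad_poly /= [ZtoC 1]rmorph1 [ZtoC 0]rmorph0 expr0 invr1; ring.
rewrite iterS exprS invfM -IHn !eval_quad_poly.
case: (iter _ _ _) => [[a b] c] /=; rewrite !ZtoCB.
apply: (mulfI x0); rewrite mulVKf //.
have -> : x * (ZtoC b - ZtoC a + (ZtoC c - ZtoC a) * x + ZtoC a * x ^+ 2) =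
  ZtoC b * x + ZtoC c * x ^+ 2 + ZtoC a * (x ^+ 3 - x ^+ 2 - x) by ring.
by rewrite x3; ring.
Qed.

(** Coordinates of beta in lambda^132 = 1 + 397 beta; [trib_root_pow132] confirms that the divisions
    are exact. *)
Definition pow132_quot : Z * Z * Z :=
  let: (a, b, c) := iter 132 pow_next (1, 0, 0)%ZZ in
  ((a - 1) / 397, b / 397, c / 397)%ZZ.

Definition powN132_quot : Z * Z * Z :=
  let: (a, b, c) := iter 132 pow_prev (1, 0, 0)%ZZ in
  ((a - 1) / 397, b / 397, c / 397)%ZZ.

Definition one_plus_397 (s : Z * Z * Z) : Z * Z * Z :=
  let: (a, b, c) := s in (1 + 397 * a, 397 * b, 397 * c)%ZZ.

Lemma eval_one_plus_397 (x : algC) s :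
  evalZ x (quad_poly (one_plus_397 s)) = evalZ x (1 + 397%:R * quad_poly s).
Proof.
rewrite evalZD evalZM -[1]/(1%:R) !evalZ_nat !eval_quad_poly.
case: s => [[a b] c] /=; rewrite ZtoCD !ZtoCM [ZtoC 1]rmorph1.
have -> : ZtoC 397 = 397%:R by rewrite -(rmorph_nat ZtoC).
by ring.
Qed.

Lemma trib_root_pow132 (x : algC) : x ^+ 3 = x ^+ 2 + x + 1 ->
  x ^+ 132 = evalZ x (1 + 397%:R * quad_poly pow132_quot).
Proof.
(* After rewriting, both sides are values of explicit quadratics whose coefficients agree by
   computation. *)
by move=> x3; rewrite -eval_one_plus_397 -eval_pow_next.
Qed.

Lemma trib_root_powN132 (x : algC) : x ^+ 3 = x ^+ 2 + x + 1 ->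
  x ^- 132 = evalZ x (1 + 397%:R * quad_poly powN132_quot).
Proof.
by move=> x3; rewrite -eval_one_plus_397 -eval_pow_prev.
Qed.

(** * Sequences with the Tribonacci recurrence *)

Definition window_at (W : int -> algC) (b : int) (s : Z * Z * Z) : Prop :=
  [/\ W b = ZtoC s.1.1, W (b + 1) = ZtoC s.1.2 & W (b + 2) = ZtoC s.2].

Definition trib_like (W : int -> algC) : Prop :=
  forall b, W (b + 3) = W (b + 2) + W (b + 1) + W b.

Lemma window_next W b s : trib_like W ->
  window_at W b s -> window_at W (b + 1) (trib_next s).
Proof.
move=> Wrec; case: s => [[x y] z] [/= Wx Wy Wz]; split => //=.
  by rewrite -Wz; congr W; ring.
have -> : b + 1 + 2 = b + 3 by ring.
by rewrite Wrec Wx Wy Wz !ZtoCD; ring.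
Qed.

Lemma window_prev W b s : trib_like W ->
  window_at W (b + 1) s -> window_at W b (trib_prev s).
Proof.
move=> Wrec; case: s => [[x y] z] [/= Wx Wy Wz]; split => //=.
  rewrite !ZtoCB -Wx -Wy -Wz.
  have -> : b + 1 + 2 = b + 3 by ring.
  have -> : b + 1 + 1 = b + 2 by ring.
  by rewrite Wrec; ring.
by rewrite -Wy; congr W; ring.
Qed.

Lemma window_iter_next W b s n : trib_like W ->
  window_at W b s -> window_at W (b + n%:Z) (iter n trib_next s).
Proof.
move=> Wrec Wb; elim: n => [|n IHn]; first by rewrite addr0.
by rewrite iterS -addn1 PoszD addrA; apply: window_next.
Qed.

Lemma window_iter_prev W b s n : trib_like W ->
  window_at W b s -> window_at W (b - n%:Z) (iter n trib_prev s).
Proof.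
move=> Wrec Wb; elim: n => [|n IHn]; first by rewrite subr0.
rewrite iterS; apply: window_prev => //.
by have -> : b - n.+1%:Z + 1 = b - n%:Z; first by rewrite -addn1 PoszD; ring.
Qed.

Lemma trib_like_value W s b : trib_like W -> window_at W 0 s ->
  exists k, W b = ZtoC k.
Proof.
move=> Wrec W0; case: b => n.
  by have [+ _ _] := window_iter_next n Wrec W0; rewrite add0r; eexists; eauto.
have [+ _ _] := window_iter_prev n.+1 Wrec W0.
by rewrite add0r -NegzE; eexists; eauto.
Qed.

Section PowerSums.

Variables (l g : 'I_3 -> algC).
Hypothesis l3 : forall i, l i ^+ 3 = l i ^+ 2 + l i + 1.

Let l0 i : l i != 0. Proof. exact: trib_root_neq0. Qed.

Definition power_sum (b : int) : algC := \sum_i g i * l i ^ b.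

Lemma power_sum_trib_like : trib_like power_sum.
Proof.
move=> b; rewrite /power_sum -!big_split; apply: eq_bigr => i _ /=.
rewrite !expfzDr // !expr1z.
have -> : l i * (l i * l i) = l i ^+ 3 by ring.
by rewrite l3; ring.
Qed.

(** A factor l i under the sum shifts the index by one, so a polynomial factor acts as a combination
    of shifts. *)
Lemma sum_evalZ_shift (b : int) (q : {poly Z}) :
  \sum_i g i * l i ^ b * evalZ (l i) q = \sum_(j < size q) ZtoC q`_j * power_sum (b + j%:Z).
Proof.
rewrite /power_sum.
under [RHS]eq_bigr do rewrite mulr_sumr.
rewrite exchange_big /=; apply: eq_bigr => i _.
rewrite /evalZ (horner_coef_wide _ (size_poly _ _)) mulr_sumr.
apply: eq_bigr => j _; rewrite coef_map /= expfzDr // -exprnP; ring.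
Qed.

(** Makes the remainders of the binomial expansion rational integers, so that congruences can be
    read in Z. *)
Lemma sum_evalZ_value (s : Z * Z * Z) (b : int) (q : {poly Z}) :
  window_at power_sum 0 s ->
  exists k, \sum_i g i * l i ^ b * evalZ (l i) q = ZtoC k.
Proof.
move=> W0; rewrite sum_evalZ_shift.
elim/big_ind: _ => [|_ _ [x ->] [y ->]|j _]; first by exists 0; rewrite rmorph0.
  by exists (x + y); rewrite rmorphD.
have [k ->] := trib_like_value (b + j%:Z) power_sum_trib_like W0.
by exists (q`_j * k); rewrite rmorphM.
Qed.

(** The values W(0), W(1), W(2); see [window_binet_cube]. *)
Hypothesis W0 : window_at power_sum 0 (3, 3, 5)%ZZ.

(** For [s] the window at b, this is the sum of g i * l i ^ b times the value of [quad_poly d] at l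
    i: the first-order coefficient of a jump. *)
Definition window_dot (d s : Z * Z * Z) : Z :=
  (d.1.1 * s.1.1 + d.1.2 * s.1.2 + d.2 * s.2)%ZZ.

Variable p : nat.
Hypotheses (p_pr : prime p) (p_gt2 : (2 < p)%N).

(** Expand (1 + p beta)^m in [{poly Z}] and sum against g i * l i ^ b. *)
Lemma power_sum_jump (n : int) (d : Z * Z * Z) (b : int) (s : Z * Z * Z) (m : nat) :
  (forall i, l i ^ n = evalZ (l i) (1 + p%:R * quad_poly d)) ->
  window_at power_sum b s -> (0 < m)%N ->
  exists k, power_sum (b + n * m%:Z) = power_sum b +
    ZtoC ((p * m)%:R * window_dot d s + p%:R ^+ (logn p m).+2 * k).
Proof.
move=> lnE [Wb0 Wb1 Wb2] m_gt0.
have [y yE] := @expr1D_logn {poly Z} p (quad_poly d) m p_pr p_gt2 m_gt0.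
have [k kE] := sum_evalZ_value b y W0; exists k.
rewrite rmorphD /= [ZtoC (_ * k)]rmorphM rmorphXn /= [ZtoC (_ * window_dot d s)]rmorphM.
rewrite !rmorph_nat /= -kE /window_dot !ZtoCD !ZtoCM.
rewrite -Wb0 -Wb1 -Wb2 /power_sum !mulr_sumr -!big_split /= !mulr_sumr.
rewrite -!big_split /=; apply: eq_bigr => i _.
rewrite expfzDr // -exprz_exp -exprnP lnE -evalZX yE.
rewrite !evalZD (evalZM _ _ (quad_poly d)) (evalZM _ _ y) evalZX.
rewrite -[1]/(1%:R) !evalZ_nat eval_quad_poly.
by rewrite !expfzDr // !expr1z; ring.
Qed.

(** If p does not divide the first-order coefficient, the linear term of the jump has valuation
    exactly [(logn p m).+1], below that of the remainder, so they cannot cancel. *)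
Lemma power_sum_no_return n d b s (m : nat) :
  (forall i, l i ^ n = evalZ (l i) (1 + p%:R * quad_poly d)) ->
  window_at power_sum b s -> (window_dot d s mod Z.of_nat p <> 0)%ZZ -> (0 < m)%N ->
  power_sum (b + n * m%:Z) <> power_sum b.
Proof.
move=> lnE Wb dot_n0 m_gt0; have [k ->] := power_sum_jump lnE Wb m_gt0.
move/eqP; rewrite -subr_eq0 addrC addKr -(rmorph0 ZtoC) => /eqP/ZtoC_inj E.
apply: dot_n0; set K := window_dot d s in E *.
have /(congr1 absz) : int_of_Z ((p * m)%:R * K) = - (int_of_Z (p%:R ^+ (logn p m).+2 * k)).
  apply/eqP; rewrite -subr_eq0 opprK -(rmorphD int_of_Z); apply/eqP.
  exact: (congr1 int_of_Z E).
rewrite abszN [int_of_Z (_ * k)]rmorphM rmorphXn /= [int_of_Z (_ * K)]rmorphM !rmorph_nat /=.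
rewrite [absz (_ * int_of_Z k)%R]abszM abszX [absz (_ * int_of_Z K)%R]abszM !natz !absz_nat.
move=> E2.
(* Zero is treated apart because [logn p 0] is 0. *)
have [K0|K0] := posnP `|int_of_Z K|.
  have : int_of_Z K = 0 by apply/eqP; rewrite -absz_eq0 K0.
  by rewrite -(rmorph0 int_of_Z) => /(can_inj int_of_ZK) ->.
have : (p ^ (logn p m).+2 %| p * m * `|int_of_Z K|)%N.
  by rewrite E2 dvdn_mulr.
have p_gt0 := prime_gt0 p_pr.
rewrite pfactor_dvdn ?muln_gt0 ?p_gt0 ?m_gt0 // !lognM ?muln_gt0 ?p_gt0 ?m_gt0 //.
rewrite (@logn_prime p p) // eqxx.
rewrite add1n addSn !ltnS -addn1 leq_add2l.
rewrite logn_gt0 mem_primes => /and3P[_ _ /dvdnP[q qE]].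
have : (p %| int_of_Z K)%Z by rewrite dvdzE qE dvdn_mull.
case/dvdzP => r rE.
have -> : K = (Z_of_int r * Z.of_nat p)%ZZ.
  apply: (can_inj int_of_ZK); rewrite rE.
  rewrite [RHS](rmorphM int_of_Z) /= Z_of_intK.
  by rewrite -[Z.of_nat p]/(Z_of_int p%:Z) Z_of_intK.
by apply: Z.mod_mul; have := prime_gt0 p_pr; lia.
Qed.

Lemma power_sum_mod n d b s (m : nat) :
  (forall i, l i ^ n = evalZ (l i) (1 + p%:R * quad_poly d)) ->
  window_at power_sum b s -> power_sum (b + n * m%:Z) = 3 ->
  (s.1.1 mod Z.of_nat p = 3 mod Z.of_nat p)%ZZ.
Proof.
move=> lnE Wb; have [Wb0 _ _] := Wb.
have Z3 x : ZtoC x = 3 -> x = 3%ZZ.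
  by rewrite -(rmorph_nat ZtoC) => /ZtoC_inj.
case: (posnP m) => [->|m_gt0]; first by rewrite mulr0 addr0 Wb0 => /Z3 ->.
have [k ->] := power_sum_jump lnE Wb m_gt0; set K := window_dot d s.
rewrite Wb0 -rmorphD => /Z3; set u : Z := m%:R * K + p%:R ^+ (logn p m).+1 * k => E.
have pE : Z.of_nat p = p%:R :> Z by rewrite -(rmorph_nat Z_of_int) natz.
have E3 : s.1.1 + p%:R * u = 3%ZZ by rewrite -E /u natrM !exprS; ring.
have -> : s.1.1 = (3 + - u * Z.of_nat p)%ZZ.
  transitivity (s.1.1 + p%:R * u + - u * p%:R); first by ring.
  by rewrite E3 -pE.
by rewrite Z.mod_add //; have := prime_gt0 p_pr; lia.
Qed.

End PowerSums.

(* -51 is the least solution, and [i] stands for the index -51 + i. *)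
Definition window_N51 : Z * Z * Z := iter 51 trib_prev (3, 3, 5)%ZZ.

(** Jumps in both directions are tested. Subtracting 51 from the listed indices gives -51, -12, -5,
    -3, 0, 1. *)
Definition sieve_check (i : nat) : bool :=
  let s := iter i trib_next window_N51 in
  (s.1.1 mod 397 =? 3)%ZZ ==>
  [&& (s.1.1 =? 3)%ZZ, ~~ (window_dot pow132_quot s mod 397 =? 0)%ZZ,
      ~~ (window_dot powN132_quot s mod 397 =? 0)%ZZ
    & i \in [:: 0; 39; 46; 48; 51; 52]%N].

Lemma sieve_checked i : (i < 132)%N -> sieve_check i.
Proof.
move=> lti; have /allP : all sieve_check (iota 0 132) by vm_compute.
by apply; rewrite mem_iota.
Qed.

Lemma power_sum_eq3 (l g : 'I_3 -> algC) (b : int) :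
  (forall i, l i ^+ 3 = l i ^+ 2 + l i + 1) ->
  window_at (power_sum l g) 0 (3, 3, 5)%ZZ ->
  power_sum l g b = 3 -> b \in [:: 0; 1; -3; -5; -12; -51].
Proof.
(* Representatives modulo 132 start at -51, so each surviving class is represented by its
   solution. *)
move=> l3 W0 Wb; set q := ((b + 51) %/ 132)%Z; set i := `|((b + 51) %% 132)%Z|%N.
have iE : i%:Z = ((b + 51) %% 132)%Z by rewrite gez0_abs ?modz_ge0.
have lti : (i < 132)%N by rewrite -ltz_nat iE ltz_pmod.
have bE : b = (0 - 51%:Z + i%:Z) + 132 * q.
  by have := divz_eq (b + 51) 132; rewrite -iE -/q; lia.
have Wi : window_at (power_sum l g) (0 - 51%:Z + i%:Z) (iter i trib_next window_N51).
  apply: window_iter_next (power_sum_trib_like g l3) _.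
  exact: window_iter_prev (power_sum_trib_like g l3) W0.
have lP j : l j ^ 132%:Z = evalZ (l j) (1 + 397%:R * quad_poly pow132_quot).
  by rewrite -exprnP trib_root_pow132.
have lN j : l j ^ (- 132%:Z) = evalZ (l j) (1 + 397%:R * quad_poly powN132_quot).
  by rewrite -invr_expz -exprnP trib_root_powN132.
move: Wi (sieve_checked lti); rewrite /sieve_check.
move: (iter i trib_next window_N51) => s Wi sieve_s.
(* The step is 132 or -132 according to the sign of [q], which keeps the multiplier [m] natural. *)
have [n [m [d [bE' ld dE]]]] : exists n m d,
  [/\ b = (0 - 51%:Z + i%:Z) + n * m%:Z,
      forall j, l j ^ n = evalZ (l j) (1 + 397%:R * quad_poly d)
    & d = pow132_quot \/ d = powN132_quot].
  case: (q) bE => m bE; first by exists 132%:Z, m, pow132_quot; split; auto.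
  exists (- 132%:Z), m.+1, powN132_quot; split; [|done|by right].
  by rewrite bE NegzE; lia.
rewrite bE' in Wb.
have sm : (s.1.1 mod 397 =? 3)%ZZ.
  apply/Z.eqb_eq; exact: (power_sum_mod l3 W0 (p := 397) isT isT ld Wi Wb).
have /and4P[s3 dP dN i_in] := implyP sieve_s sm.
have [m0|m_gt0] := posnP m.
  rewrite bE' m0 mulr0 addr0; move: i_in; rewrite !inE; lia.
have [] := power_sum_no_return l3 W0 (p := 397) isT isT ld Wi _ m_gt0.
  by case: dE => ->; apply/Z.eqb_neq; apply/negbTE.
rewrite Wb; have [-> _ _] := Wi; have /Z.eqb_eq-> := s3.
by rewrite -[RHS](rmorph_nat ZtoC 3).
Qed.

(** * Powers of the real root *)

Lemma trib_real_root_bounds (R : realFieldType) (t : R) :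
  0 < t -> t ^+ 3 = t ^+ 2 + t + 1 -> 3 / 2 < t /\ t < 2.
Proof. by move=> t0 t3; split; rewrite ltNge; apply/negP => ?; nra. Qed.

(* [r] has norm 1 and conjugates summing to [tau]; [e] and [f] are the first two
   elementary symmetric functions of the three, and the bounds leave only
   e = 0 and f = -1. *)
Lemma unit_trace_bounds (R : realFieldType) (r tau : R) (e f : int) :
  1 < r -> r ^+ 2 < 2 -> r * tau ^+ 2 <= 4 ->
  e%:~R = r + tau -> r * f%:~R = 1 + r ^+ 2 * tau -> r ^+ 3 = r + 1.
Proof.
move=> r1 r2 tau4 eE fE; have r32 : r < 3 / 2 by nra.
have P : r ^+ 3 - e%:~R * r ^+ 2 + f%:~R * r - 1 = 0.
  by rewrite [f%:~R * r]mulrC fE eE; ring.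
(* Otherwise (r + 1)^2 <= r^2 tau^2 <= 4 r, contradicting r > 1. *)
have tau_lt : r * tau < r + 1.
  rewrite ltNge; apply/negP => h.
  have : (r + 1) ^+ 2 <= r ^+ 2 * tau ^+ 2 by nra.
  by nra.
(* Indeed e - f = (r - 1) ((r + 1) / r - tau). *)
have fe : f%:~R < e%:~R :> R by nra.
rewrite ltr_int in fe.
(* With f <= e - 1, having e >= 1 would give r^3 - r^2 - 1 >= 0, which fails for r^2 < 2. *)
have e0 : e <= 0.
  rewrite leNgt; apply/negP => e_gt0.
  have e1 : 1 <= e%:~R :> R by rewrite ler1z; lia.
  have d1 : 1 <= e%:~R - f%:~R :> R by rewrite -rmorphB ler1z; lia.
  by nra.
(* Having f <= -2 would give (1 + 2 r)^2 <= r^4 tau^2 <= 4 r^3, which fails for r < 3/2. *)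
have f1 : -1 <= f.
  rewrite leNgt; apply/negP => f_lt.
  have f2 : f%:~R <= - 2 :> R.
    have -> : (-2 : R) = (-2 : int)%:~R by rewrite rmorphN.
    by rewrite ler_int; lia.
  have h : r ^+ 2 * tau <= - (1 + 2 * r) by nra.
  have h2 : (1 + 2 * r) ^+ 2 <= (r ^+ 2 * tau) ^+ 2 by nra.
  have h3 : (r ^+ 2 * tau) ^+ 2 <= 4 * r ^+ 3 by nra.
  by nra.
have [eE0 fE1] : e = 0 /\ f = -1 by lia.
by move: P; rewrite eE0 fE1 rmorphN /=; lra.
Qed.

(** For n >= 2, r^2 <= t < 2 forces r^3 = r + 1. Then n >= 3 gives t >= r + 1 > 2, and n = 2 turns
    the cubic of t into r^2 = r. *)
Lemma trib_not_unit_power (R : realFieldType) (r t tau : R) (e f : int) (n : nat) :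
  0 < t -> t ^+ 3 = t ^+ 2 + t + 1 -> 0 < r -> r ^+ n = t ->
  r * tau ^+ 2 <= 4 -> e%:~R = r + tau -> r * f%:~R = 1 + r ^+ 2 * tau ->
  n = 1%N.
Proof.
move=> t0 t3 r0 rn tau4 eE fE; have [t_gt t_lt] := trib_real_root_bounds t0 t3.
have r1 : 1 < r.
  rewrite ltNge; apply/negP => r_le1.
  have : r ^+ n <= 1 by rewrite exprn_ile1 // ltW.
  by rewrite rn; lra.
case: n rn => [|[//|[|n]]] rn; exfalso.
- by move: rn; rewrite expr0; lra.
- have r3 : r ^+ 3 = r + 1 by apply: unit_trace_bounds r1 _ tau4 eE fE; rewrite rn.
  by nra.
have rle m : 1 <= r ^+ m by rewrite exprn_ege1 // ltW.
have r2 : r ^+ 2 < 2.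
  have := rle n.+1; have : r ^+ n.+3 = r ^+ 2 * r ^+ n.+1 by rewrite -exprD.
  by nra.
have r3 : r ^+ 3 = r + 1 := unit_trace_bounds r1 r2 tau4 eE fE.
have := rle n; have : r ^+ n.+3 = r ^+ 3 * r ^+ n by rewrite -exprD.
by nra.
Qed.

(** Substituting X^n into the minimal polynomial of x^n gives a monic integral polynomial vanishing
    at x. *)
Lemma Aint_of_exp (x : algC) n : (0 < n)%N -> x ^+ n \in Aint -> x \in Aint.
Proof.
move=> n0 xn; apply: (@root_monic_Aint (minCpoly (x ^+ n) \Po 'X^n)).
- by rewrite rootE horner_comp hornerXn -rootE root_minCpoly.
- rewrite monicE lead_coef_comp ?size_polyXn // (monicP (minCpoly_monic _)).
  by rewrite lead_coefXn expr1n mulr1.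
- by rewrite polyOver_comp // rpredX // polyOverX.
Qed.

(** * The three roots, complex conjugation and the Binet coefficients *)

Record trib_triple (x y z : algC) : Prop := TribTriple {
  triple_sum : x + y + z = 1;
  triple_sum2 : x * y + y * z + z * x = - 1;
  triple_prod : x * y * z = 1 }.

Lemma triple_rot x y z : trib_triple x y z -> trib_triple y z x.
Proof. by case=> E1 E2 E3; split; [rewrite -E1|rewrite -E2|rewrite -E3]; ring. Qed.

Lemma triple_poly x y z u : trib_triple x y z ->
  u ^+ 3 - u ^+ 2 - u - 1 = (u - x) * (u - y) * (u - z).
Proof.
case=> E1 E2 E3.
have -> : (u - x) * (u - y) * (u - z) =
  u ^+ 3 - (x + y + z) * u ^+ 2 + (x * y + y * z + z * x) * u - x * y * z by ring.
by rewrite E1 E2 E3; ring.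
Qed.

Lemma triple_cube x y z : trib_triple x y z -> x ^+ 3 = x ^+ 2 + x + 1.
Proof.
move=> T; have := triple_poly x T; rewrite subrr !mul0r => E.
by apply/eqP; rewrite -subr_eq0 -E; apply/eqP; ring.
Qed.

Lemma triple_mem x y z u : trib_triple x y z -> u ^+ 3 = u ^+ 2 + u + 1 ->
  [\/ u = x, u = y | u = z].
Proof.
move=> T u3; have /esym/eqP := triple_poly u T.
rewrite u3 (_ : _ - _ - _ - _ = 0); last by ring.
by rewrite !mulf_eq0 !subr_eq0 => /orP[/orP[]|] /eqP ->; [apply: Or31|apply: Or32|apply: Or33].
Qed.

(** The discriminant of the cubic: nonzero, so the roots are distinct; negative, so they are not all
    real. *)
Lemma triple_disc x y z : trib_triple x y z ->
  ((x - y) * (y - z) * (z - x)) ^+ 2 = - 44.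
Proof.
case=> E1 E2 E3.
have -> : ((x - y) * (y - z) * (z - x)) ^+ 2 =
    (x + y + z) ^+ 2 * (x * y + y * z + z * x) ^+ 2
    - 4 * (x * y + y * z + z * x) ^+ 3 - 4 * (x + y + z) ^+ 3 * (x * y * z)
    + 18 * (x + y + z) * (x * y + y * z + z * x) * (x * y * z)
    - 27 * (x * y * z) ^+ 2 by ring.
by rewrite E1 E2 E3; ring.
Qed.

Lemma triple_neq x y z : trib_triple x y z -> x != y.
Proof.
move=> T; apply: contra_eqN (triple_disc T) => /eqP ->.
by rewrite subrr !mul0r expr0n /= eq_sym oppr_eq0 pnatr_eq0.
Qed.

Lemma triple_aut (nu : {rmorphism algC -> algC}) x y z :
  trib_triple x y z -> trib_triple (nu x) (nu y) (nu z).
Proof.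
case=> E1 E2 E3; split; rewrite -?rmorphM -?rmorphD ?E1 ?E2 ?E3 ?rmorphN ?rmorph1 //.
Qed.

(** Indices are added modulo 3, so any root, in particular the real one, can be put first. *)
Lemma big_ord3_rot (R : Type) (idx : R) (op : Monoid.com_law idx) (F : 'I_3 -> R) (i : 'I_3) :
  \big[op/idx]_j F j = op (F i) (op (F (i + 1)) (F (i + 2))).
Proof.
rewrite (reindex_inj (addrI i)) !big_ord_recl big_ord0 addr0 Monoid.mulm1.
have -> : i + lift ord0 ord0 = i + 1 by congr (_ + _); apply: val_inj.
by have -> : i + lift ord0 (lift ord0 ord0) = i + 2 by congr (_ + _); apply: val_inj.
Qed.

Lemma trib_roots_triple (lambda : 'I_3 -> algC) (i : 'I_3) :
  trib_roots lambda -> trib_triple (lambda i) (lambda (i + 1)) (lambda (i + 2)).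
Proof.
rewrite /trib_roots (big_ord3_rot _ _ i) /=.
move: (lambda i) (lambda (i + 1)) (lambda (i + 2)) => x y z PE.
have E (u : algC) : u ^+ 3 - u ^+ 2 - u - 1 = (u - x) * ((u - y) * (u - z)).
  by have := congr1 (horner^~ u) PE; rewrite /trib_poly /= !hornerE.
have n2 : (2 : algC) != 0 by rewrite pnatr_eq0.
have E3 : x * y * z = 1.
  by apply: oppr_inj; transitivity ((0 - x) * ((0 - y) * (0 - z))); [ring|rewrite -E; ring].
(* The sum and the difference of the values at 1 and -1 isolate the remaining two symmetric
   functions. *)
have := E 1; have := E (-1) => Em Ep.
have S : 2 * (x + y + z) = 2.
  have : (-1 - x) * ((-1 - y) * (-1 - z)) + (1 - x) * ((1 - y) * (1 - z)) = -4.
    by rewrite -Em -Ep; ring.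
  have -> : (-1 - x) * ((-1 - y) * (-1 - z)) + (1 - x) * ((1 - y) * (1 - z)) =
    - 2 * (x + y + z) - 2 * (x * y * z) by ring.
  rewrite E3 => h; have -> : 2 * (x + y + z) = - (- 2 * (x + y + z) - 2 * 1) - 2 by ring.
  by rewrite h; ring.
have S2 : 2 * (x * y + y * z + z * x) = - 2.
  have : (1 - x) * ((1 - y) * (1 - z)) - (-1 - x) * ((-1 - y) * (-1 - z)) = 0.
    by rewrite -Em -Ep; ring.
  have -> : (1 - x) * ((1 - y) * (1 - z)) - (-1 - x) * ((-1 - y) * (-1 - z)) =
    2 + 2 * (x * y + y * z + z * x) by ring.
  by move/eqP; rewrite addrC addr_eq0 => /eqP.
split=> //; apply: (mulfI n2); first by rewrite S mulr1.
by rewrite S2 mulrN1.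
Qed.

Lemma triple_conj_mem x y z : trib_triple x y z ->
  [\/ x^* = x, x^* = y | x^* = z].
Proof.
move=> T; apply: (triple_mem T).
by rewrite -rmorphXn (triple_cube T) !rmorphD rmorphXn rmorph1.
Qed.

(** If conjugation fixed y as well, all roots would be real and the discriminant a nonnegative
    square. *)
Lemma triple_real_conj x y z : trib_triple x y z -> x^* = x -> z = y^*.
Proof.
move=> T xR; have Ty := triple_rot T; have Tz := triple_rot Ty.
case: (triple_conj_mem Ty) => [yR|//|yx]; last first.
  have := triple_neq T; rewrite -(can_eq (@conjCK algC)) xR yx.
  by rewrite eqxx.
have zR : z^* = z.
  case: (triple_conj_mem Tz) => // zE.
    have := triple_neq Tz; by rewrite -[z]conjCK zE xR eqxx.
  by have := triple_neq Ty; rewrite -[z]conjCK zE yR eqxx.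
have : 0 <= ((x - y) * (y - z) * (z - x)) ^+ 2.
  rewrite real_exprn_even_ge0 //; apply/CrealP.
  by rewrite !rmorphM !rmorphB /= xR yR zR.
by rewrite (triple_disc T) oppr_ge0 lern0.
Qed.

(** Conjugation is an involution of a set of three roots, so it has a fixed point. *)
Lemma trib_roots_real (lambda : 'I_3 -> algC) : trib_roots lambda ->
  exists i, (lambda i)^* = lambda i.
Proof.
move=> /(trib_roots_triple 0) T; have Ty := triple_rot T; have Tz := triple_rot Ty.
case: (triple_conj_mem T) => E; first by exists 0.
  exists (0 + 2); case: (triple_conj_mem Tz) => // zE.
    by have := triple_neq Ty; rewrite -E -zE conjCK eqxx.
  by have := triple_neq Tz; rewrite -[lambda (0 + 2)]conjCK zE -E conjCK eqxx.
exists (0 + 1); case: (triple_conj_mem Ty) => // yE.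
  by have := triple_neq T; rewrite -[lambda 0]conjCK E -yE conjCK eqxx.
by have := triple_neq Ty; rewrite -E -yE conjCK eqxx.
Qed.

(** The coefficient x / P'(x) as a polynomial in the root x, reduced modulo P. *)
Definition binet_coef (x : algC) : algC := (5 * x ^+ 2 - 3 * x - 4) / 22.

Lemma binet_coef22 (x : algC) : 22 * binet_coef x = 5 * x ^+ 2 - 3 * x - 4.
Proof. by rewrite /binet_coef mulrC divfK // pnatr_eq0. Qed.

Lemma binet_coef_deriv (x : algC) : x ^+ 3 = x ^+ 2 + x + 1 ->
  binet_coef x * (3 * x ^+ 2 - 2 * x - 1) = x.
Proof.
move=> x3; have n22 : (22 : algC) != 0 by rewrite pnatr_eq0.
apply: (mulfI n22); rewrite mulrA binet_coef22.
apply/eqP; rewrite -subr_eq0.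
have -> : (5 * x ^+ 2 - 3 * x - 4) * (3 * x ^+ 2 - 2 * x - 1) - 22 * x =
  (x ^+ 3 - (x ^+ 2 + x + 1)) * (15 * x - 4) by ring.
by rewrite x3 subrr mul0r.
Qed.

Lemma trib_coefE (lambda : 'I_3 -> algC) i : trib_roots lambda ->
  trib_coef lambda i = binet_coef (lambda i).
Proof.
move=> H; have x3 := trib_root i H; have := trib_deriv_neq0 i H.
rewrite /trib_coef; set d := _.[_] => d0.
have dE : d = 3 * lambda i ^+ 2 - 2 * lambda i - 1.
  by rewrite /d /trib_poly !derivE !hornerE /=; ring.
by rewrite -{1}(binet_coef_deriv x3) -dE mulfK.
Qed.

Lemma binet_coef_cube (x : algC) : x ^+ 3 = x ^+ 2 + x + 1 ->
  44 * binet_coef x ^+ 3 = 2 * binet_coef x + 1.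
Proof.
(* 242 * 44 = 22^3 clears the denominator of [binet_coef]. *)
move=> x3; have n : (242 : algC) != 0 by rewrite pnatr_eq0.
apply: (mulfI n); apply/eqP; rewrite -subr_eq0.
have -> : 242 * (44 * binet_coef x ^+ 3) - 242 * (2 * binet_coef x + 1) =
  (22 * binet_coef x) ^+ 3 - 22 * (22 * binet_coef x) - 242 by ring.
rewrite binet_coef22.
have -> : (5 * x ^+ 2 - 3 * x - 4) ^+ 3 - 22 * (5 * x ^+ 2 - 3 * x - 4) - 242 =
  (x ^+ 3 - (x ^+ 2 + x + 1)) * (125 * x ^+ 3 - 100 * x ^+ 2 - 140 * x + 218) by ring.
by rewrite x3 subrr mul0r.
Qed.

Lemma binet_coef_neq0 (x : algC) : x ^+ 3 = x ^+ 2 + x + 1 -> binet_coef x != 0.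
Proof.
move=> x3; have := trib_root_neq0 x3; rewrite -{1}(binet_coef_deriv x3).
by rewrite mulf_eq0 negb_or => /andP[].
Qed.

Lemma binet_coef_aut (nu : {rmorphism algC -> algC}) x :
  nu (binet_coef x) = binet_coef (nu x).
Proof.
by rewrite /binet_coef !expr2 fmorph_div !rmorphB !rmorphM !rmorph_nat.
Qed.

Lemma binet_coef_diff x y z : trib_triple x y z ->
  binet_coef x * ((x - y) * (x - z)) = x.
Proof.
move=> T; rewrite -[RHS](binet_coef_deriv (triple_cube T)); congr (_ * _).
case: T => E1 E2 _.
transitivity (3 * x ^+ 2 - 2 * x * (x + y + z) + (x * y + y * z + z * x)); first by ring.
by rewrite E1 E2; ring.
Qed.

(** The product of the P'(x_i) is minus the discriminant, and the roots multiply to 1. *)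
Lemma binet_coef_prod x y z : trib_triple x y z ->
  44 * (binet_coef x * binet_coef y * binet_coef z) = 1.
Proof.
move=> T; have Ty := triple_rot T; have Tz := triple_rot Ty.
rewrite -[RHS](triple_prod T) -[44]opprK -(triple_disc T).
transitivity (binet_coef x * ((x - y) * (x - z)) * (binet_coef y * ((y - z) * (y - x)))
  * (binet_coef z * ((z - x) * (z - y)))); first by ring.
by rewrite (binet_coef_diff T) (binet_coef_diff Ty) (binet_coef_diff Tz).
Qed.

(** The coefficients 3, 1, 3 are the power sums of the roots of orders 0, 1, 2. *)
Lemma binet_power_sum3 x y z (a b c : algC) : trib_triple x y z ->
  a + b * x + c * x ^+ 2 + (a + b * y + c * y ^+ 2 + (a + b * z + c * z ^+ 2)) =
    3 * a + b + 3 * c.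
Proof.
case=> E1 E2 _.
have -> : a + b * x + c * x ^+ 2 + (a + b * y + c * y ^+ 2 + (a + b * z + c * z ^+ 2)) =
  3 * a + b * (x + y + z) + c * ((x + y + z) ^+ 2 - 2 * (x * y + y * z + z * x)) by ring.
by rewrite E1 E2; ring.
Qed.

Section RealTriple.

Variables t w : algC.
Hypotheses (T : trib_triple t w w^*) (tR : t^* = t).

Let t3 : t ^+ 3 = t ^+ 2 + t + 1. Proof. exact: triple_cube T. Qed.
Let Tw : trib_triple w w^* t. Proof. exact: triple_rot T. Qed.
Let tw : t != w. Proof. exact: triple_neq T. Qed.
Let wwb : w != w^*. Proof. exact: triple_neq Tw. Qed.
Let twb : t != w^*. Proof. by rewrite eq_sym; exact: triple_neq (triple_rot Tw). Qed.

Lemma triple_root_gt0 : 0 < t.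
Proof.
have w0 : w != 0 by apply: trib_root_neq0; exact: triple_cube Tw.
have := triple_prod T; rewrite -mulrA -normCK => E.
have : 0 < t * `|w| ^+ 2 by rewrite E.
by rewrite pmulr_lgt0 // exprn_gt0 // normr_gt0.
Qed.

(** Moves t into the ordered field [algR], where real inequalities can be used. *)
Lemma triple_root_lift : exists2 t' : algR, t = algRval t' &
  0 < t' /\ t' ^+ 3 = t' ^+ 2 + t' + 1.
Proof.
have tC : t \is Creal by apply/CrealP.
exists (in_algR tC) => //; split; first exact: triple_root_gt0.
by apply: (fmorph_inj algRval); rewrite !rmorphD !rmorphXn rmorph1.
Qed.

Lemma binet_coef_real_gt0 : 0 < binet_coef t.
Proof.
have [t' tE [t0 t'3]] := triple_root_lift; have [lt _] := trib_real_root_bounds t0 t'3.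
have n22 : 0 < 22 :> algC by rewrite ltr0n.
rewrite -(pmulr_rgt0 _ n22) binet_coef22 tE.
have : 0 < 5 * t' ^+ 2 - 3 * t' - 4 by nra.
have -> : 5 * algRval t' ^+ 2 - 3 * algRval t' - 4 = algRval (5 * t' ^+ 2 - 3 * t' - 4).
  by rewrite !rmorphB !rmorphM !rmorph_nat.
by [].
Qed.

Lemma triple_aut_mem (nu : {rmorphism algC -> algC}) x :
  x ^+ 3 = x ^+ 2 + x + 1 -> [\/ nu x = t, nu x = w | nu x = w^*].
Proof.
by move=> x3; apply: triple_mem T _; rewrite -rmorphXn x3 !rmorphD rmorphXn rmorph1.
Qed.

Lemma Aint_trib_root : t \in Aint.
Proof.
apply: (@root_monic_Aint trib_poly).
- by rewrite rootE /trib_poly !hornerE t3; apply/eqP; ring.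
- have -> : trib_poly = 'X^3 + (- 'X^2 - 'X - 1) by rewrite /trib_poly; ring.
  rewrite monicE lead_coefDl ?lead_coefXn // size_polyXn ltnS.
  rewrite -!opprD size_polyN (leq_trans (size_polyD _ _)) // size_poly1 geq_max andbT.
  by rewrite (leq_trans (size_polyD _ _)) // size_polyXn size_polyX.
by apply/polyOverP => i; rewrite /trib_poly !coefB !coefXn coefX coef1 !rpredB ?rpred_nat.
Qed.

(** A rational algebraic integer is an integer, but 1 < t < 2. *)
Lemma triple_root_notin_Crat : t \notin Crat.
Proof.
apply/negP => /Cint_rat_Aint/(_ Aint_trib_root)/intrP[m mE].
have [t' tE [t0 t'3]] := triple_root_lift; have := trib_real_root_bounds t0 t'3.
have -> : t' = m%:~R by apply: (fmorph_inj algRval); rewrite /= -tE mE rmorph_int.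
case=> l r; have l1 : (1 : int)%:~R < m%:~R :> algR by lra.
have r1 : m%:~R < (2 : int)%:~R :> algR by lra.
by move: l1 r1; rewrite !ltr_int; lia.
Qed.

(** If no automorphism sent t to w, composing with conjugation would exclude w^* too, and t, fixed
    by all automorphisms, would be rational. *)
Lemma triple_aut_exists : exists nu : {rmorphism algC -> algC}, nu t = w.
Proof.
apply: algC_conjugate_aut; apply: contraNT triple_root_notin_Crat => n_root.
apply: Crat_aut_fixed => nu.
have no_w (mu : {rmorphism algC -> algC}) : mu t <> w.
  by move=> E; case/negP: n_root; rewrite -(minCpoly_aut mu t) E root_minCpoly.
case: (triple_aut_mem nu t3) => // E; first by case: (no_w nu).
by case: (no_w (Num.conj \o nu)); rewrite /= E conjCK.
Qed.

(** The invariance places r in Q(t). Its conjugates over t, w, w^* are algebraic integers with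
    rational, hence integral, symmetric functions, as [trib_not_unit_power] requires. *)
Lemma aut_fixed_root_eq1 (r : algC) (n : nat) : 0 < r -> r ^+ n = t ->
  (forall nu : {rmorphism algC -> algC}, nu t = t -> nu r = r) -> n = 1%N.
Proof.
move=> r0 rn fix_r; have [sg sgt] := triple_aut_exists.
have n0 : (0 < n)%N.
  rewrite lt0n; apply/eqP => n0; move: triple_root_notin_Crat.
  by rewrite -rn n0 expr0 Crat1.
pose r2 := sg r; pose r3 := r2^*.
(* [R] sends a root to the conjugate of r lying over it; automorphisms commute with [R] because nu r
   depends only on nu t. *)
pose R z := if z == t then r else if z == w then r2 else r3.
have Rt : R t = r by rewrite /R eqxx.
have Rw : R w = r2 by rewrite /R eq_sym (negPf tw) eqxx.
have Rwb : R w^* = r3 by rewrite /R eq_sym (negPf twb) eq_sym (negPf wwb).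
have to_w (nu : {rmorphism algC -> algC}) : nu t = w -> nu r = r2.
  move=> nut; apply: (can_inj (algC_invautK sg)) => /=.
  rewrite /r2 algC_autK; apply: (fix_r (algC_invaut sg \o nu)).
  by rewrite /= nut -sgt algC_autK.
have toR (nu : {rmorphism algC -> algC}) : nu r = R (nu t).
  case: (triple_aut_mem nu t3) => E; rewrite E ?Rt ?Rw ?Rwb.
  - exact: fix_r.
  - exact: to_w.
  by rewrite /r3 -(to_w (Num.conj \o nu)) /= ?E conjCK.
have autR (nu : {rmorphism algC -> algC}) :
    [/\ nu r = R (nu t), nu r2 = R (nu w) & nu r3 = R (nu w^*)].
  split; first exact: toR.
    by rewrite -sgt; exact: (toR (nu \o sg)).
  by rewrite /r3 -sgt; exact: (toR (nu \o (Num.conj \o sg))).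
(* Two adjacent transpositions generate all permutations of the three conjugates. *)
have symR (S : algC -> algC -> algC -> algC) (nu : {rmorphism algC -> algC}) :
    (forall a b c, S a b c = S b a c) -> (forall a b c, S a b c = S a c b) ->
  S (nu r) (nu r2) (nu r3) = S r r2 r3.
  move=> S1 S2; have [-> -> ->] := autR nu; rewrite -Rt -Rw -Rwb.
  have N1 := triple_neq (triple_aut nu T); have N2 := triple_neq (triple_aut nu Tw).
  have N3 := triple_neq (triple_aut nu (triple_rot Tw)).
  have w3 := triple_cube Tw; have wb3 := triple_cube (triple_rot Tw).
  move: N1 N2 N3.
  case: (triple_aut_mem nu t3) => ->; case: (triple_aut_mem nu w3) => ->;
  case: (triple_aut_mem nu wb3) => ->; rewrite ?eqxx // => _ _ _.
  - by rewrite S2 S1.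
  - by rewrite S1 S2.
  - by rewrite S1 S2 S1.
have r_int : r \in Aint by apply: (Aint_of_exp n0); rewrite rn Aint_trib_root.
have r2_int : r2 \in Aint by rewrite /r2 Aint_aut.
have r3_int : r3 \in Aint by rewrite /r3 Aint_aut.
have /intrP[e eE] : r + r2 + r3 \in Num.int.
  apply: Cint_rat_Aint; last by rewrite !rpredD.
  apply: Crat_aut_fixed => nu; rewrite !rmorphD.
  by apply: (symR (fun a b c => a + b + c)) => a b c; ring.
have /intrP[f fE] : r * r2 + r2 * r3 + r3 * r \in Num.int.
  apply: Cint_rat_Aint; last by rewrite !rpredD // rpredM.
  apply: Crat_aut_fixed => nu; rewrite !rmorphD !rmorphM.
  by apply: (symR (fun a b c => a * b + b * c + c * a)) => a b c; ring.
(* The product is a nonnegative real whose n-th power is the product of the roots, namely 1. *)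
have r23 : r * (r2 * r3) = 1.
  rewrite /r3 -normCK; have rr : 0 <= r * `|r2| ^+ 2 by rewrite mulr_ge0 ?exprn_ge0 // ltW.
  apply: (pexpIrn n0); rewrite ?nnegrE ?ler01 // expr1n normCK -/r3.
  rewrite !exprMn /r3 /r2 -!rmorphXn rn sgt mulrA; exact: triple_prod T.
have [t' tE [t0 t'3]] := triple_root_lift.
have rC : r \is Creal by rewrite gtr0_real.
have tauC : r2 + r3 \is Creal by apply/CrealP; rewrite rmorphD /= /r3 conjCK addrC.
pose r' := in_algR rC; pose tau := in_algR tauC.
have inj := fmorph_inj algRval.
have r'0 : 0 < r' by exact: r0.
apply: (trib_not_unit_power t0 t'3 r'0 _ (tau := tau) (e := e) (f := f)).
- by apply: inj; rewrite rmorphXn /= -tE.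
(* As r2 and r3 are complex conjugate, |r2 - r3|^2 = 4 r2 r3 - (r2 + r3)^2; multiply by r. *)
- have : 0 <= - (r2 - r3) ^+ 2.
    have -> : - (r2 - r3) ^+ 2 = `|r2 - r3| ^+ 2.
      by rewrite normCK rmorphB /= /r3 conjCK; ring.
    by rewrite exprn_ge0.
  have -> : - (r2 - r3) ^+ 2 = 4 * (r2 * r3) - (r2 + r3) ^+ 2 by ring.
  move/(mulr_ge0 (ltW r0)); rewrite mulrBr mulrCA r23 mulr1 subr_ge0 => h.
  suff : algRval (r' * tau ^+ 2) <= algRval 4 by [].
  by rewrite rmorphM rmorphXn rmorph_nat.
- by apply: inj; rewrite rmorph_int rmorphD /= -eE addrA.
apply: inj; rewrite rmorphM rmorph_int !rmorphD rmorph1 rmorphM rmorphXn /= -fE.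
transitivity (r * (r2 * r3) + r ^+ 2 * (r2 + r3)); first by ring.
by rewrite r23.
Qed.

End RealTriple.

(** * Twisted relations *)

Lemma isosceles_ratio (a b c : algC) : a + b + c = 0 -> `|b| = `|c| -> b != 0 ->
  a ^+ 2 / (b * c) = `|a| ^+ 2 / `|b| ^+ 2.
Proof.
move=> abc bc b0; have c0 : c != 0 by rewrite -normr_eq0 -bc normr_eq0.
have aE : a = - (b + c) by apply/eqP; rewrite -addr_eq0 addrA abc.
have bcN : b * b^* = c * c^* by rewrite -!normCK bc.
have nb0 : `|b| ^+ 2 != 0 by rewrite expf_neq0 // normr_eq0.
have bc0 : b * c != 0 by rewrite mulf_neq0.
apply/eqP; rewrite eqr_div //; apply/eqP.
rewrite aE normrN !normCK rmorphD /= sqrrN.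
transitivity ((b + c) * (b * (b * b^*) + c * (b * b^*))); first by ring.
by rewrite {1}bcN; ring.
Qed.

Lemma pos_expIrn (R : numDomainType) (x y : R) n : (0 < n)%N ->
  0 <= x -> 0 <= y -> x ^+ n = y ^+ n -> x = y.
Proof. by move=> n0 x0 y0; apply: pexpIrn. Qed.

Section TwistedPower.

Variables (k : int) (L : nat).
Hypothesis L0 : (0 < L)%N.

(** The L-th power of alpha l^(k/L), free of any choice of determination. *)
Definition binet_power (l : algC) : algC := binet_coef l ^+ L * l ^ k.

(** Says that x is alpha l^(k/L) up to a root of unity, absorbing both the twist and the
    determination. *)
Definition twisted_term (l x : algC) : Prop :=
  exists2 M, (0 < M)%N & (x ^+ L / binet_power l) ^+ M = 1.

Lemma binet_power_aut (nu : {rmorphism algC -> algC}) l :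
  nu (binet_power l) = binet_power (nu l).
Proof. by rewrite /binet_power rmorphM rmorphXn fmorphXz /= binet_coef_aut. Qed.

Lemma twisted_term_aut (nu : {rmorphism algC -> algC}) l x :
  twisted_term l x -> twisted_term (nu l) (nu x).
Proof.
case=> M M0 E; exists M => //.
by rewrite -binet_power_aut -rmorphXn -fmorph_div -rmorphXn E rmorph1.
Qed.

Lemma binet_power_neq0 l : l ^+ 3 = l ^+ 2 + l + 1 -> binet_power l != 0.
Proof.
by move=> l3; rewrite mulf_neq0 ?expf_neq0 ?expfz_neq0 ?binet_coef_neq0 ?trib_root_neq0.
Qed.

Lemma twisted_term_norm l x : l ^+ 3 = l ^+ 2 + l + 1 ->
  twisted_term l x -> `|x| ^+ L = `|binet_power l|.
Proof.
move=> l3 [M M0 E]; have b0 := binet_power_neq0 l3.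
have /eqP : `|x ^+ L / binet_power l| = 1.
  by apply: (pos_expIrn M0); rewrite ?normr_ge0 ?ler01 // -normrX E normr1 expr1n.
rewrite normf_div normrX -(divr1 1) eqr_div ?oner_eq0 ?normr_eq0 //.
by rewrite mulr1 mul1r => /eqP.
Qed.

Lemma twisted_term_norm_eq l l' x x' :
  l ^+ 3 = l ^+ 2 + l + 1 -> l' ^+ 3 = l' ^+ 2 + l' + 1 ->
  `|binet_power l| = `|binet_power l'| ->
  twisted_term l x -> twisted_term l' x' -> `|x| = `|x'|.
Proof.
move=> l3 l'3 E Tx Tx'; apply: (pos_expIrn L0); rewrite ?normr_ge0 //.
by rewrite (twisted_term_norm l3 Tx) (twisted_term_norm l'3 Tx').
Qed.

Lemma twisted_term_neq0 l x : l ^+ 3 = l ^+ 2 + l + 1 -> twisted_term l x -> x != 0.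
Proof.
move=> l3 /(twisted_term_norm l3); apply: contra_eqN => /eqP ->.
by rewrite normr0 expr0n eqn0Ngt L0 /= eq_sym normr_eq0 binet_power_neq0.
Qed.

Variables t w : algC.
Hypotheses (T : trib_triple t w w^*) (tR : t^* = t).

Let t3 : t ^+ 3 = t ^+ 2 + t + 1. Proof. exact: triple_cube T. Qed.
Let Tw : trib_triple w w^* t. Proof. exact: triple_rot T. Qed.
Let w3 : w ^+ 3 = w ^+ 2 + w + 1. Proof. exact: triple_cube Tw. Qed.
Let wb3 : w^* ^+ 3 = w^* ^+ 2 + w^* + 1. Proof. exact: triple_cube (triple_rot Tw). Qed.

Lemma norm_binet_power_conj : `|binet_power w^*| = `|binet_power w|.
Proof. by rewrite -[binet_power _](binet_power_aut Num.conj) norm_conjC. Qed.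

Definition twisted_zero (x : algC * algC * algC) : Prop :=
  [/\ twisted_term t x.1.1, twisted_term w x.1.2, twisted_term w^* x.2
    & x.1.1 + x.1.2 + x.2 = 0].

Definition apex_ratio (x : algC * algC * algC) : algC := x.1.1 ^+ 2 / (x.1.2 * x.2).

(* By the isosceles shape the ratio depends only on the lengths of the sides,
   which the twisting by roots of unity does not affect. *)
Lemma apex_ratio_unique x y : twisted_zero x -> twisted_zero y ->
  apex_ratio x = apex_ratio y.
Proof.
case=> X1 X2 X3 Sx [Y1 Y2 Y3 Sy]; rewrite /apex_ratio.
have nC := norm_binet_power_conj.
have x23 : `|x.1.2| = `|x.2| by apply: twisted_term_norm_eq X2 X3.
have y23 : `|y.1.2| = `|y.2| by apply: twisted_term_norm_eq Y2 Y3.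
rewrite (isosceles_ratio Sx x23 (twisted_term_neq0 w3 X2)).
rewrite (isosceles_ratio Sy y23 (twisted_term_neq0 w3 Y2)).
by rewrite (twisted_term_norm_eq _ _ _ X1 Y1) // (twisted_term_norm_eq _ _ _ X2 Y2).
Qed.

Definition flip (x : algC * algC * algC) : algC * algC * algC := (x.1.1, x.2, x.1.2).

Lemma apex_ratio_flip x : apex_ratio (flip x) = apex_ratio x.
Proof. by rewrite /apex_ratio /= [x.2 * _]mulrC. Qed.

(** Such an automorphism fixes or swaps w and w^*, so it yields another twisted zero, up to [flip],
    with the same ratio. *)
Lemma apex_ratio_aut_fixed (nu : {rmorphism algC -> algC}) x :
  twisted_zero x -> nu t = t -> nu (apex_ratio x) = apex_ratio x.
Proof.
move=> Zx nut; have [X1 X2 X3 Sx] := Zx.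
have Sn : nu x.1.1 + nu x.1.2 + nu x.2 = 0 by rewrite -!rmorphD Sx rmorph0.
pose y := (nu x.1.1, nu x.1.2, nu x.2).
have -> : nu (apex_ratio x) = apex_ratio y by rewrite /apex_ratio fmorph_div rmorphXn rmorphM.
have := (twisted_term_aut nu X1, twisted_term_aut nu X2, twisted_term_aut nu X3).
have N1 := triple_neq (triple_aut nu T).
have N2 := triple_neq (triple_rot (triple_rot (triple_aut nu T))).
have N3 := triple_neq (triple_rot (triple_aut nu T)).
rewrite nut in N1 N2 *.
move: N1 N2 N3; case: (triple_aut_mem T nu w3) => ->; rewrite ?eqxx //;
  case: (triple_aut_mem T nu wb3) => ->; rewrite ?eqxx // => _ _ _ [[Y1 Y2] Y3].
  by apply: apex_ratio_unique.
rewrite -apex_ratio_flip; apply: apex_ratio_unique => //.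
by split=> //=; rewrite addrAC.
Qed.

Lemma apex_ratio_gt0 x : twisted_zero x -> 0 < apex_ratio x.
Proof.
case=> X1 X2 X3 Sx; have x1 := twisted_term_neq0 t3 X1; have x2 := twisted_term_neq0 w3 X2.
rewrite /apex_ratio isosceles_ratio //; first by rewrite divr_gt0 // exprn_gt0 // normr_gt0.
by apply: twisted_term_norm_eq X2 X3 => //; rewrite norm_binet_power_conj.
Qed.

(** The norms of w and of its coefficient come from w w^* = 1/t and the product of the Binet
    coefficients being 1/44. *)
Lemma apex_ratio_expL x : twisted_zero x ->
  apex_ratio x ^+ L = (44 * binet_coef t ^+ 3) ^+ L * t ^ (k * 3).
Proof.
case=> X1 X2 X3 Sx; have x2 := twisted_term_neq0 w3 X2.
have t0 := triple_root_gt0 T; have A0 := binet_coef_real_gt0 T tR.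
have nE : `|x.1.2| = `|x.2|.
  by apply: twisted_term_norm_eq X2 X3 => //; rewrite norm_binet_power_conj.
rewrite /apex_ratio isosceles_ratio // expr_div_n ![_ ^+ 2 ^+ L]exprAC.
rewrite (twisted_term_norm t3 X1) (twisted_term_norm w3 X2).
have -> : `|binet_power w| ^+ 2 = (44 * binet_coef t) ^- L * t ^ (- k).
  have wE : (binet_power w)^* = binet_power w^* := binet_power_aut Num.conj w.
  rewrite normCK wE /binet_power.
  rewrite mulrACA -exprMn -expfzMl.
  have -> : w * w^* = t^-1.
    by apply: (mulfI (lt0r_neq0 t0)); rewrite mulfV ?lt0r_neq0 // mulrA (triple_prod T).
  have -> : binet_coef w * binet_coef w^* = (44 * binet_coef t)^-1.
    have a0 : 44 * binet_coef t != 0 by rewrite mulf_neq0 ?pnatr_eq0 ?lt0r_neq0.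
    by apply: (mulfI a0); rewrite mulfV // -[RHS](binet_coef_prod T); ring.
  by rewrite exprVn exprz_inv.
rewrite ger0_norm; last by rewrite /binet_power mulr_ge0 ?exprn_ge0 ?exprz_ge0 // ltW.
rewrite /binet_power invfM invrK invr_expz opprK.
have -> : k * 3 = k + k + k by ring.
rewrite !expfzDr ?lt0r_neq0 // exprMn.
have -> : 44 * binet_coef t ^+ 3 = binet_coef t * binet_coef t * (44 * binet_coef t) by ring.
by rewrite !exprMn; ring.
Qed.

(** Let s be the ratio over 44 alpha^3, so s^L = t^(3k). With g = gcd(3k, L) = 3k u + L v, the
    element s^u t^v is an (L/g)-th root of t fixed with t, so L = g divides 3k. *)
Lemma apex_ratio_integral x : twisted_zero x ->
  exists b : int, k * 3 = b * L%:Z /\ apex_ratio x = 44 * binet_coef t ^+ 3 * t ^ b.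
Proof.
move=> Zx; have t0 := triple_root_gt0 T; have A0 := binet_coef_real_gt0 T tR.
pose A := 44 * binet_coef t ^+ 3; have A1 : 0 < A by rewrite mulr_gt0 ?ltr0n // exprn_gt0.
pose s := apex_ratio x / A; have s0 : 0 < s by rewrite divr_gt0 // apex_ratio_gt0.
have sA : apex_ratio x = A * s by rewrite mulrC divfK ?lt0r_neq0.
have sL : s ^+ L = t ^ (k * 3).
  rewrite expr_div_n apex_ratio_expL // mulrAC mulfV ?mul1r //.
  by rewrite expf_neq0 // lt0r_neq0.
have s_fix (nu : {rmorphism algC -> algC}) : nu t = t -> nu s = s.
  move=> nut; rewrite fmorph_div apex_ratio_aut_fixed // /A rmorphM rmorphXn rmorph_nat /=.
  by rewrite binet_coef_aut nut.
have [u [v uvE]] := Bezoutz (k * 3) L%:Z.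
set g := gcdz _ _ in uvE.
have [b bE] : exists b, k * 3 = b * g by apply/dvdzP; exact: dvdz_gcdl.
have g0 : 0 < g by rewrite /g /gcdz ltz_nat gcdn_gt0 absz_nat L0 orbT.
have [n nE] : exists n : nat, L = (n * `|g|)%N by apply/dvdnP; exact: (dvdz_gcdr (k * 3) L).
have gE : `|g|%N%:Z = g by rewrite gez0_abs // ltW.
have gn0 : (0 < `|g|)%N by rewrite -ltz_nat gE.
pose r := s ^ u * t ^ v; have r0 : 0 < r by rewrite mulr_gt0 ?exprz_gt0.
have rn : r ^+ n = t.
  apply: (pos_expIrn gn0); rewrite ?exprn_ge0 ?ltW // -exprM -nE.
  rewrite exprMn [(s ^ u) ^+ L]exprnP [(t ^ v) ^+ L]exprnP !exprz_exp.
  rewrite [u * _]mulrC -(exprz_exp s L%:Z u) (sL : s ^ L%:Z = _).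
  by rewrite exprz_exp -expfzDr ?lt0r_neq0 // [_ * u]mulrC uvE -gE.
have n1 : n = 1%N.
  apply: (aut_fixed_root_eq1 T tR r0 rn) => nu nut.
  by rewrite rmorphM !fmorphXz /= s_fix // nut.
have LE : L%:Z = g by rewrite nE n1 mul1n gE.
exists b; rewrite LE; split=> //; rewrite sA; congr (_ * _).
apply: (pos_expIrn L0); rewrite ?ltW ?exprz_gt0 //.
by rewrite sL [_ ^+ L]exprnP exprz_exp LE bE.
Qed.

End TwistedPower.

(** Equivalent to a^3 + b^3 + c^3 = 3 a b c when a + b + c = 0. *)
Lemma square_ratios_sum (F : fieldType) (a b c : F) :
  a + b + c = 0 -> a != 0 -> b != 0 -> c != 0 ->
  a ^+ 2 / (b * c) + b ^+ 2 / (a * c) + c ^+ 2 / (a * b) = 3.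
Proof.
move=> abc a0 b0 c0; have cE : c = - (a + b).
  by apply/eqP; rewrite -addr_eq0 addrC abc.
rewrite cE oppr_eq0 in c0 *.
by field; rewrite a0 b0 oppr_eq0 c0.
Qed.

Lemma twisted_zero_sum (k : int) (L : nat) (t w : algC) (b : int) x : (0 < L)%N ->
  trib_triple t w w^* -> t^* = t -> twisted_zero k L t w x ->
  apex_ratio x = 44 * binet_coef t ^+ 3 * t ^ b ->
  44 * (binet_coef t ^+ 3 * t ^ b + binet_coef w ^+ 3 * w ^ b
        + binet_coef w^* ^+ 3 * w^* ^ b) = 3.
Proof.
move=> L0 T tR Zx ratioE; have [sg sgt] := triple_aut_exists T tR.
have t3 := triple_cube T; have w3 := triple_cube (triple_rot T).
have wb3 := triple_cube (triple_rot (triple_rot T)).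
(* Applying [sg] permutes the roots; the image terms are reordered so that the image of the apex
   sits over w. *)
have [y Zy y2] : exists2 y, twisted_zero k L t w y &
    y.1.2 ^+ 2 / (y.1.1 * y.2) = sg (apex_ratio x).
  have [X1 X2 X3 Sx] := Zx.
  have := (twisted_term_aut sg X1, twisted_term_aut sg X2, twisted_term_aut sg X3).
  have N1 := triple_neq (triple_aut sg T).
  have N2 := triple_neq (triple_rot (triple_rot (triple_aut sg T))).
  have N3 := triple_neq (triple_rot (triple_aut sg T)).
  have Sn : sg x.1.1 + sg x.1.2 + sg x.2 = 0 by rewrite -!rmorphD Sx rmorph0.
  rewrite sgt in N1 N2 *; rewrite /apex_ratio fmorph_div rmorphXn rmorphM /=.
  move: N1 N2 N3; case: (triple_aut_mem T sg w3) => ->; rewrite ?eqxx //;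
    case: (triple_aut_mem T sg wb3) => ->; rewrite ?eqxx // => _ _ _ [[Y1 Y2] Y3].
    exists (sg x.1.2, sg x.1.1, sg x.2) => //.
    by split=> //=; rewrite [sg x.1.2 + _]addrC.
  exists (sg x.2, sg x.1.1, sg x.1.2); last by rewrite /= [sg x.2 * _]mulrC.
  by split=> //=; rewrite -addrA addrC.
have [Y1 Y2 Y3 Sy] := Zy.
have y1n := twisted_term_neq0 L0 t3 Y1; have y2n := twisted_term_neq0 L0 w3 Y2.
have y3n := twisted_term_neq0 L0 wb3 Y3.
pose P l := 44 * (binet_coef l ^+ 3 * l ^ b).
have P1 : y.1.1 ^+ 2 / (y.1.2 * y.2) = P t.
  by rewrite -[LHS](apex_ratio_unique L0 T Zx Zy) ratioE /P mulrA.
have P2 : y.1.2 ^+ 2 / (y.1.1 * y.2) = P w.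
  rewrite y2 ratioE rmorphM fmorphXz [sg (44 * _)]rmorphM rmorphXn rmorph_nat /= binet_coef_aut sgt.
  by rewrite /P mulrA.
have PP : P t * P w * P w^* = 1.
  transitivity ((44 * (binet_coef t * binet_coef w * binet_coef w^*)) ^+ 3
    * (t ^ b * w ^ b * w^* ^ b)); first by rewrite /P; ring.
  by rewrite (binet_coef_prod T) -!expfzMl (triple_prod T) expr1n exp1rz mulr1.
(* The three ratios multiply to 1, as do the three values of [P], so two matches force the third. *)
have P3 : y.2 ^+ 2 / (y.1.1 * y.1.2) = P w^*.
  have Pn : P t * P w != 0.
    by apply: contra_eqN PP => /eqP ->; rewrite mul0r eq_sym oner_eq0.
  apply: (mulfI Pn); rewrite PP -P1 -P2.
  by field; rewrite y1n y2n y3n.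
by rewrite -(square_ratios_sum Sy y1n y2n y3n) P1 P2 P3 /P; ring.
Qed.

(** * From twisted zeros to W(b) = 3 and back *)

Lemma ord3_ind (P : 'I_3 -> Prop) : P 0 -> P 1 -> P 2 -> forall i, P i.
Proof.
move=> P0 P1 P2 [[|[|[|//]]] i3].
- by rewrite (_ : Ordinal i3 = 0) //; apply: val_inj.
- by rewrite (_ : Ordinal i3 = 1) //; apply: val_inj.
- by rewrite (_ : Ordinal i3 = 2) //; apply: val_inj.
Qed.

Section Roots.

Variable lambda : 'I_3 -> algC.
Hypothesis lambdaP : trib_roots lambda.

Let l3 i : lambda i ^+ 3 = lambda i ^+ 2 + lambda i + 1.
Proof. exact: trib_root. Qed.

Lemma power_sum_quadratic (g : 'I_3 -> algC) (b : int) (u v s : algC) :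
  (forall i, g i * lambda i ^ b = u + v * lambda i + s * lambda i ^+ 2) ->
  power_sum lambda g b = 3 * u + v + 3 * s.
Proof.
move=> gE; rewrite /power_sum (big_ord3_rot _ _ 0) /= !gE.
exact: binet_power_sum3 (trib_roots_triple 0 lambdaP).
Qed.

Definition binet_cube (i : 'I_3) : algC := 44 * binet_coef (lambda i) ^+ 3.

Lemma window_binet_cube : window_at (power_sum lambda binet_cube) 0 (3, 3, 5)%ZZ.
Proof.
have n11 : (11 : algC) != 0 by rewrite pnatr_eq0.
have n22 : (22 : algC) != 0 by rewrite pnatr_eq0.
have gE i : binet_cube i = 7 / 11 + (- 3 / 11) * lambda i + 5 / 11 * lambda i ^+ 2.
  by rewrite /binet_cube binet_coef_cube // /binet_coef; field; rewrite ?n11 ?n22.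
have Z3 : ZtoC 3%ZZ = 3 := rmorph_nat ZtoC 3.
have Z5 : ZtoC 5%ZZ = 5 := rmorph_nat ZtoC 5.
split; rewrite /= ?add0r ?Z3 ?Z5.
- rewrite (@power_sum_quadratic _ _ (7 / 11) (- 3 / 11) (5 / 11)); first by field.
  by move=> i; rewrite expr0z mulr1 gE.
- rewrite (@power_sum_quadratic _ _ (5 / 11) (12 / 11) (2 / 11)); first by field.
  move=> i; rewrite expr1z gE; transitivity (7 / 11 * lambda i + (- 3 / 11) * lambda i ^+ 2
    + 5 / 11 * lambda i ^+ 3); first by ring.
  by rewrite l3; field.
rewrite (@power_sum_quadratic _ _ (2 / 11) (7 / 11) (14 / 11)); first by field.
move=> i; rewrite -exprnP gE; transitivity (7 / 11 * lambda i ^+ 2 + (- 3 / 11) * lambda i ^+ 3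
    + 5 / 11 * lambda i ^+ 3 * lambda i); first by ring.
rewrite l3; transitivity ((5 * lambda i ^+ 3 + 9 * lambda i ^+ 2 + 2 * lambda i - 3) / 11);
  first by ring.
by rewrite l3; field.
Qed.

Lemma window_binet :
  window_at (power_sum lambda (fun i => binet_coef (lambda i))) 0 (0, 1, 1)%ZZ.
Proof.
have n22 : (22 : algC) != 0 by rewrite pnatr_eq0.
have Z0 : ZtoC 0%ZZ = 0 := rmorph0 ZtoC.
have Z1 : ZtoC 1%ZZ = 1 := rmorph1 ZtoC.
split; rewrite /= ?add0r ?Z0 ?Z1.
- rewrite (@power_sum_quadratic _ _ (- 4 / 22) (- 3 / 22) (5 / 22)); first by field.
  by move=> i; rewrite expr0z mulr1 /binet_coef; field.
- rewrite (@power_sum_quadratic _ _ (5 / 22) (1 / 22) (2 / 22)); first by field.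
  move=> i; rewrite expr1z /binet_coef.
  transitivity ((5 * lambda i ^+ 3 - 3 * lambda i ^+ 2 - 4 * lambda i) / 22); first by ring.
  by rewrite l3; field.
rewrite (@power_sum_quadratic _ _ (2 / 22) (7 / 22) (3 / 22)); first by field.
move=> i; rewrite -exprnP /binet_coef.
transitivity ((5 * lambda i * lambda i ^+ 3 - 3 * lambda i ^+ 3 - 4 * lambda i ^+ 2) / 22);
  first by ring.
rewrite l3; transitivity ((5 * lambda i ^+ 3 + 5 * lambda i ^+ 2 + 5 * lambda i
  - 3 * (lambda i ^+ 2 + lambda i + 1) - 4 * lambda i ^+ 2) / 22); first by ring.
by rewrite l3; field.
Qed.

(** Raising a term to the power [denq a] turns the determination into an integer power of the root,
    so the terms form a [twisted_zero] headed by the real root. *)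
Lemma twisted_zero_cube_sum (a : rat) : twisted_rational_zero lambda a ->
  exists2 b : int, numq a * 3 = b * denq a & power_sum lambda binet_cube b = 3.
Proof.
case=> xi [y [xiP yP sum0]].
have [i0 tR] := trib_roots_real lambdaP; have T := trib_roots_triple i0 lambdaP.
have wE := triple_real_conj T tR; rewrite wE in T.
have dE : `|denq a|%N%:Z = denq a by rewrite gez0_abs ?denq_ge0.
have L0 : (0 < `|denq a|)%N by rewrite absz_gt0 denq_neq0.
pose x i := xi i * trib_coef lambda i * y i.
have xP i : twisted_term (numq a) `|denq a| (lambda i) (x i).
  have [M [M0 xiM]] := xiP i; have [mu [muE yE]] := yP i; exists M => //.
  have mu0 : mu != 0.
    apply: contraTneq (trib_root_neq0 (l3 i)) => mu0.
    by rewrite -muE mu0 exp0rz denq_eq0 /= negbK.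
  rewrite /x trib_coefE // yE.
  have -> : (xi i * binet_coef (lambda i) * mu ^ numq a) ^+ `|denq a| =
      xi i ^+ `|denq a| * binet_power (numq a) `|denq a| (lambda i).
    rewrite /binet_power exprMn [(_ * binet_coef _) ^+ _]exprMn -mulrA; congr (_ * (_ * _)).
    by rewrite exprnP dE exprz_exp mulrC -exprz_exp muE.
  rewrite mulfK ?binet_power_neq0 //.
  by rewrite exprAC; move/unity_rootP: xiM => ->; rewrite expr1n.
have Zx : twisted_zero (numq a) `|denq a| (lambda i0) (lambda (i0 + 1))
    (x i0, x (i0 + 1), x (i0 + 2)).
  split=> //=; first by rewrite -wE.
  by rewrite -addrA -[RHS]sum0 (big_ord3_rot _ _ i0).
have [b [bE ratioE]] := apex_ratio_integral L0 T tR Zx.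
exists b; first by rewrite bE dE.
rewrite -(twisted_zero_sum L0 T tR Zx ratioE) -wE /power_sum (big_ord3_rot _ _ i0) /binet_cube /=.
by ring.
Qed.

Lemma rat_of_third (a : rat) (b : int) : numq a * 3 = b * denq a -> a = b%:~R / 3.
Proof.
move=> E; have d0 : (denq a)%:~R != 0 :> rat by rewrite intr_eq0 denq_neq0.
rewrite -[LHS]divq_num_den; apply/eqP; rewrite eqr_div //; apply/eqP.
by rewrite -[3]/(3%:~R) -!intrM E.
Qed.

Lemma root_of_unity1 : Defs.root_of_unity 1.
Proof. by exists 1%N; split=> //; apply/unity_rootP. Qed.

Lemma twisted_rational_zero_int (n : int) :
  power_sum lambda (fun i => binet_coef (lambda i)) n = 0 ->
  twisted_rational_zero lambda n%:~R.
Proof.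
move=> E; exists (fun=> 1), (fun i => lambda i ^ n); split=> [i|i|].
- exact: root_of_unity1.
- by exists (lambda i); rewrite numq_int denq_int expr1z.
rewrite -[RHS]E; apply: eq_bigr => i _; rewrite mul1r trib_coefE //.
Qed.

(* x^3 + y^3 + z^3 - 3xyz splits into the forms x + w^j y + w^(2j) z. *)
Lemma sum_cubes_eq0 (x y z : algC) : x ^+ 3 + y ^+ 3 + z ^+ 3 = 3 * (x * y * z) ->
  exists2 om, om ^+ 3 = 1 & x + om * y + om ^+ 2 * z = 0.
Proof.
move=> E; have [om omP] := @C_prim_root_exists 3 isT.
have om3 : om ^+ 3 = 1 := prim_expr_order omP.
have om1 : om - 1 != 0.
  by rewrite subr_eq0 -[om]expr1 -(prim_order_dvd omP).
have om2 : om + om ^+ 2 = - 1.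
  apply: (mulfI om1); transitivity (om ^+ 3 - om); first by ring.
  by rewrite om3; ring.
have om4 : om ^+ 2 ^+ 2 = om by rewrite -exprM (exprS om 3) om3 mulr1.
have : (x + y + z) * ((x + om * y + om ^+ 2 * z) * (x + om ^+ 2 * y + om * z)) = 0.
  transitivity ((x + y + z) * (x ^+ 2 + om ^+ 3 * (y ^+ 2 + z ^+ 2)
    + (om + om ^+ 2) * (x * y + x * z) + (om ^+ 2 + om ^+ 2 ^+ 2) * (y * z))); first by ring.
  rewrite om4 om3 [_ ^+ 2 + om]addrC om2.
  by transitivity (x ^+ 3 + y ^+ 3 + z ^+ 3 - 3 * (x * y * z)); [ring | rewrite E subrr].
move/eqP; rewrite !mulf_eq0 => /or3P[] /eqP h.
- by exists 1; rewrite ?expr1n ?mul1r.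
- by exists om.
by exists (om ^+ 2); rewrite ?om4 // -exprM mulnC exprM om3 expr1n.
Qed.

(** With cube roots of product 1 the untwisted terms have product 1/44 and cubes summing to W(numq
    a)/44 = 3/44, so [sum_cubes_eq0] supplies the twists 1, om, om^2. *)
Lemma twisted_rational_zero_third (a : rat) : denq a = 3 ->
  power_sum lambda binet_cube (numq a) = 3 -> twisted_rational_zero lambda a.
Proof.
move=> d3 E; have T := trib_roots_triple 0 lambdaP.
have l0 i := trib_root_neq0 (l3 i).
pose m0 := 3.-root (lambda 0); pose m1 := 3.-root (lambda (0 + 1)).
(* Chosen to make the product of the three cube roots exactly 1. *)
pose m2 := (m0 * m1)^-1.
have m03 : m0 ^+ 3 = lambda 0 by rewrite rootCK.
have m13 : m1 ^+ 3 = lambda (0 + 1) by rewrite rootCK.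
have m23 : m2 ^+ 3 = lambda (0 + 2).
  rewrite exprVn exprMn m03 m13; apply: (mulfI (mulf_neq0 (l0 0) (l0 (0 + 1)))).
  by rewrite mulfV ?mulf_neq0 // (triple_prod T).
have m0n : m0 != 0 by rewrite rootC_eq0.
have m1n : m1 != 0 by rewrite rootC_eq0.
pose f (u v s : algC) (i : 'I_3) := if i == 0 then u else if i == 1 then v else s.
pose A i := binet_coef (lambda i).
have [om om3 omE] : exists2 om, om ^+ 3 = 1 &
    A 0 * m0 ^ numq a + om * (A (0 + 1) * m1 ^ numq a)
    + om ^+ 2 * (A (0 + 2) * m2 ^ numq a) = 0.
  apply: sum_cubes_eq0.
  have n44 : (44 : algC) != 0 by rewrite pnatr_eq0.
  have cube m i : m ^+ 3 = lambda i -> (A i * m ^ numq a) ^+ 3 = A i ^+ 3 * lambda i ^ numq a.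
    by move=> <-; rewrite exprMn !exprnP !exprz_exp [_ * 3]mulrC.
  rewrite (cube _ _ m03) (cube _ _ m13) (cube _ _ m23); apply: (mulfI n44).
  transitivity (power_sum lambda binet_cube (numq a)).
    by rewrite /power_sum (big_ord3_rot _ _ 0) /binet_cube /A /=; ring.
  rewrite E; transitivity (3 * (44 * (A 0 * A (0 + 1) * A (0 + 2))) * (m0 * m1 * m2) ^ numq a).
    by rewrite (binet_coef_prod T) /m2 mulfV ?mulf_neq0 // exp1rz !mulr1.
  by rewrite !expfzMl; ring.
have rou (z : algC) : z ^+ 3 = 1 -> Defs.root_of_unity z.
  by move=> z3; exists 3%N; split=> //; apply/unity_rootP.
exists (f 1 om (om ^+ 2)), (f (m0 ^ numq a) (m1 ^ numq a) (m2 ^ numq a)); split.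
- by apply: ord3_ind; rewrite /f /=; apply: rou; rewrite ?expr1n // -exprM mulnC exprM om3 expr1n.
- apply: ord3_ind; rewrite /f /=; [exists m0|exists m1|exists m2]; rewrite d3; split=> //.
    by rewrite -exprnP m13 add0r.
  by rewrite -exprnP m23 add0r.
rewrite (big_ord3_rot _ _ 0) /= /f /= !trib_coefE // -omE /A; ring.
Qed.

End Roots.

Lemma window_prev_value (W : int -> algC) (s : Z * Z * Z) (n : nat) (v : Z) :
  trib_like W -> window_at W 0 s -> (iter n trib_prev s).1.1 = v ->
  W (- n%:Z) = ZtoC v.
Proof. by move=> Wrec W0 <-; have [+ _ _] := window_iter_prev n Wrec W0; rewrite sub0r. Qed.

Theorem theorem1p10 (lambda : 'I_3 -> algC) (lambdaP : trib_roots lambda)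
    (a : rat) :
  twisted_rational_zero lambda a <->
    a \in [:: 0; - 1; - 4; - 17; 1 / 3; - (5 / 3)].
Proof.
have l3 i : lambda i ^+ 3 = lambda i ^+ 2 + lambda i + 1 by exact: trib_root.
split.
  move/(twisted_zero_cube_sum lambdaP) => [b bE].
  move/(power_sum_eq3 l3 (window_binet_cube lambdaP)); rewrite (rat_of_third bE) {bE}.
  (* Dividing 0, 1, -3, -5, -12, -51 by 3 gives the six zeros. *)
  by rewrite !inE => /or4P[|||/or3P[]] /eqP ->.
have zero_at n : (iter n trib_prev (0, 1, 1)%ZZ).1.1 = 0%ZZ ->
    twisted_rational_zero lambda (- n%:Z)%:~R.
  move=> E; apply: (twisted_rational_zero_int lambdaP).
  have -> := window_prev_value (power_sum_trib_like _ l3) (window_binet lambdaP) E.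
  exact: rmorph0.
have Z3 : ZtoC 3%ZZ = 3 := rmorph_nat ZtoC 3.
(* The integer zeros are read off the backward Tribonacci windows; 1/3 and -5/3 come from W(1) =
   W(-5) = 3. *)
rewrite !inE => /or4P[|||/or3P[]] /eqP ->.
- exact: (zero_at 0%N).
- exact: (zero_at 1%N).
- exact: (zero_at 4%N).
- exact: (zero_at 17%N).
- apply: (twisted_rational_zero_third lambdaP) => //.
  by have [_ + _] := window_binet_cube lambdaP; rewrite add0r Z3.
apply: (twisted_rational_zero_third lambdaP) => //.
rewrite -Z3.
exact: (window_prev_value (n := 5) (power_sum_trib_like _ l3) (window_binet_cube lambdaP)).
Qed.
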